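(* Up to isomorphism, the class of free hypergraph C*-algebras coincides with the class of finite colimits, in the category $\mathsf{C^*alg}_1$, of finite-dimensional commutative C*-algebras. That is: for every hypergraph $H$, the C*-algebra $C^*(H)$ is isomorphic to the colimit of some diagram $D : \mathsf{J} \to \mathsf{C^*alg}_1$ with $\mathsf{J}$ a finite category and every $D(J)$, $J\in\mathsf{J}$, commutative and finite-dimensional; and conversely, the colimit of every such diagram is isomorphic to $C^*(H)$ for some hypergraph $H$.
   Context: $\mathsf{C^*alg}_1$ is the category of unital C*-algebras (including the zero algebra) and unital $*$-homomorphisms. A hypergraph $H$ consists of a finite set of vertices $V(H)$ and a collection of edges $E(H) \subseteq 2^{V(H)}$ (the empty edge is allowed) such that every vertex is contained in at least one edge. The free hypergraph C*-algebra $C^*(H)$ is the universal unital C*-algebra (in $\mathsf{C^*alg}_1$) generated by elements $(p_v)_{v\in V(H)}$ subject to the relations $p_v = p_v^* = p_v^2$ for all $v \in V(H)$ and $\sum_{v\in e} p_v = 1$ for all $e\in E(H)$. Finite-dimensional commutative C*-algebras are, up to isomorphism, the $\mathbb{C}^n$ with $n \ge 0$. *)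

(* Defs.v *)
From HB Require Import structures.
From mathcomp Require Import all_boot all_order all_algebra.
From mathcomp Require Import complex.
From mathcomp Require Import all_classical all_reals all_analysis.

Set Implicit Arguments.
Unset Strict Implicit.
Unset Printing Implicit Defensive.

Import Order.TTheory GRing.Theory Num.Theory.
Import numFieldNormedType.Exports.

Local Open Scope ring_scope.

(* The multiplication is declared here rather than inherited from a ring
   structure: the algebra structures of ssralg impose 1 != 0 and so exclude the
   zero C*-algebra, and they have no join with normed modules.  For the same
   reason `|1| = 1 is not an axiom; in a nonzero algebra it follows from the
   C*-identity.  Norms take their values in the nonnegative reals of R[i]. *)
HB.mixin Record isCStarAlgebra (R : realType) A
    of CompleteNormedModule R[i] A := {
  cone : A;
  cmul : A -> A -> A;
  star : A -> A;
  cmulA : associative cmul;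
  cmul1x : left_id cone cmul;
  cmulx1 : right_id cone cmul;
  cmulDl : left_distributive cmul +%R;
  cmulDr : right_distributive cmul +%R;
  cmulZl : forall (k : R[i]) (x y : A), cmul (k *: x) y = k *: cmul x y;
  cmulZr : forall (k : R[i]) (x y : A), cmul x (k *: y) = k *: cmul x y;
  cstar_normM : forall x y : A, `|cmul x y| <= `|x| * `|y|;
  starD : forall x y : A, star (x + y) = star x + star y;
  starZ : forall (k : R[i]) (x : A), star (k *: x) = k^* *: star x;
  starM : forall x y : A, star (cmul x y) = cmul (star y) (star x);
  starK : involutive star;
  cstar_identity : forall x : A, `|cmul (star x) x| = `|x| ^+ 2
}.

#[short(type="cstarAlgType")]
HB.structure Definition CStarAlgebra (R : realType) :=
  {A of CompleteNormedModule R[i] A & isCStarAlgebra R A}.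

Arguments cone {R A} : rename.
Notation "x '**' y" := (cmul x y) (at level 40, left associativity) : ring_scope.

HB.mixin Record isStarMorphism (R : realType) (A B : cstarAlgType R)
    (f : A -> B) := {
  star_morph1 : f cone = cone;
  star_morphM : forall x y : A, f (x ** y) = f x ** f y;
  star_morph_star : forall x : A, f (star x) = star (f x)
}.

#[short(type="starMorphism")]
HB.structure Definition StarMorphism (R : realType) (A B : cstarAlgType R) :=
  {f of @GRing.Linear R[i] A B *:%R f & isStarMorphism R A B f}.

Section StarMorphismCategory.
Variable R : realType.
Implicit Types A B C : cstarAlgType R.

Lemma starMorphism_eq A B (f g : starMorphism A B) : f =1 g -> f = g.
Proof.
case: f g => [f cf] [g cg] /= /funext fg.
subst g; congr (StarMorphism.Pack _).
destruct cf as [[m1] [m2] [u1 uM uS]], cg as [[n1] [n2] [v1 vM vS]].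
by rewrite (Prop_irrelevance m1 n1) (Prop_irrelevance m2 n2)
  (Prop_irrelevance u1 v1) (Prop_irrelevance uM vM) (Prop_irrelevance uS vS).
Qed.

Lemma star_morph1_id A : idfun (cone : A) = cone.
Proof. by []. Qed.
Lemma star_morphM_id A (x y : A) : idfun (x ** y) = idfun x ** idfun y.
Proof. by []. Qed.
Lemma star_morph_star_id A (x : A) : idfun (star x) = star (idfun x).
Proof. by []. Qed.

HB.instance Definition _ A := isStarMorphism.Build R A A idfun
  (@star_morph1_id A) (@star_morphM_id A) (@star_morph_star_id A).

Section Comp.
Variables (A B C : cstarAlgType R).
Variables (g : starMorphism B C) (f : starMorphism A B).

Lemma star_morph1_comp : (g \o f) cone = cone.
Proof. by rewrite /= !star_morph1. Qed.
Lemma star_morphM_comp x y : (g \o f) (x ** y) = (g \o f) x ** (g \o f) y.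
Proof. by rewrite /= !star_morphM. Qed.
Lemma star_morph_star_comp x : (g \o f) (star x) = star ((g \o f) x).
Proof. by rewrite /= !star_morph_star. Qed.

HB.instance Definition _ := isStarMorphism.Build R A C (g \o f)
  star_morph1_comp star_morphM_comp star_morph_star_comp.
End Comp.

Definition starMorphism_id A : starMorphism A A := idfun.
Definition starMorphism_comp A B C
  (g : starMorphism B C) (f : starMorphism A B) : starMorphism A C := g \o f.

End StarMorphismCategory.

Record category := Category {
  obj : Type;
  hom : obj -> obj -> Type;
  catid : forall X, hom X X;
  catcomp : forall X Y Z, hom Y Z -> hom X Y -> hom X Z;
  catcompA : forall X Y Z W (h : hom Z W) (g : hom Y Z) (f : hom X Y),
    catcomp h (catcomp g f) = catcomp (catcomp h g) f;
  catcomp1f : forall X Y (f : hom X Y), catcomp (catid Y) f = f;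
  catcompf1 : forall X Y (f : hom X Y), catcomp f (catid X) = f
}.

Arguments hom {c}.
Arguments catid {c}.
Arguments catcomp {c X Y Z}.

(* [finite_set] cannot be used here: it would force [obj J] into the universe of
   the carriers of C*-algebras, which is too small for [cstar_alg1] below. *)
Definition finitely_many (T : Type) : Prop :=
  exists (n : nat) (f : 'I_n -> T), forall x : T, exists i : 'I_n, f i = x.

Definition finite_category (J : category) : Prop :=
  finitely_many (obj J) /\ forall i j : obj J, finitely_many (hom i j).

Definition isomorphic (C : category) (X Y : obj C) : Prop :=
  exists (f : hom X Y) (g : hom Y X),
    catcomp g f = catid X /\ catcomp f g = catid Y.

Record functor (J C : category) := Functor {
  fobj :> obj J -> obj C;
  fmap : forall i j, hom i j -> hom (fobj i) (fobj j);
  fmap_id : forall i, fmap (catid i) = catid (fobj i);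
  fmap_comp : forall i j k (v : hom j k) (u : hom i j),
    fmap (catcomp v u) = catcomp (fmap v) (fmap u)
}.

Arguments fmap {J C} f {i j}.

Record cocone (J C : category) (D : functor J C) (X : obj C) := Cocone {
  leg :> forall j : obj J, hom (D j) X;
  leg_natural : forall (i j : obj J) (u : hom i j),
    catcomp (leg j) (fmap D u) = leg i
}.

Definition is_colimit (J C : category) (D : functor J C) (L : obj C) : Prop :=
  exists c : cocone D L, forall (X : obj C) (c' : cocone D X),
    exists! h : hom L X, forall j : obj J, catcomp h (c j) = c' j.

Section CStarCategory.
Variable R : realType.

Lemma starMorphism_compA (A B C D : cstarAlgType R) (h : starMorphism C D)
    (g : starMorphism B C) (f : starMorphism A B) :
  starMorphism_comp h (starMorphism_comp g f) =
  starMorphism_comp (starMorphism_comp h g) f.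
Proof. exact: starMorphism_eq. Qed.

Lemma starMorphism_comp1f (A B : cstarAlgType R) (f : starMorphism A B) :
  starMorphism_comp (starMorphism_id B) f = f.
Proof. exact: starMorphism_eq. Qed.

Lemma starMorphism_compf1 (A B : cstarAlgType R) (f : starMorphism A B) :
  starMorphism_comp f (starMorphism_id A) = f.
Proof. exact: starMorphism_eq. Qed.

Definition cstar_alg1 : category :=
  Category starMorphism_compA starMorphism_comp1f starMorphism_compf1.

Definition finite_dimensional (A : lmodType R[i]) : Prop :=
  exists (n : nat) (b : 'I_n -> A),
    forall x : A, exists k : 'I_n -> R[i], x = \sum_(i < n) k i *: b i.

Definition commutative_cstar (A : cstarAlgType R) : Prop :=
  commutative (@cmul R A).

Definition projection (A : cstarAlgType R) (p : A) : Prop :=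
  star p = p /\ p ** p = p.

End CStarCategory.

Record hypergraph := Hypergraph {
  vertex : finType;
  edges : {set {set vertex}};
  vertex_covered : forall v : vertex, exists2 e, e \in edges & v \in e
}.

Section FreeHypergraphCStar.
Variables (R : realType) (H : hypergraph).

Definition hypergraph_relations (A : cstarAlgType R) (p : vertex H -> A) :=
  (forall v, projection (p v)) /\
  (forall e, e \in edges H -> \sum_(v in e) p v = cone).

Definition is_free_hypergraph_cstar (A : cstarAlgType R) : Prop :=
  exists p : vertex H -> A, hypergraph_relations p /\
    forall (B : cstarAlgType R) (q : vertex H -> B), hypergraph_relations q ->
      exists! f : starMorphism A B, forall v, f (p v) = q v.

End FreeHypergraphCStar.

(* Main.v *)
From HB Require Import structures.
Require Import Defs.
From mathcomp Require Import all_boot all_order all_algebra.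
From mathcomp Require Import complex.
From mathcomp Require Import all_classical all_reals all_analysis.
From mathcomp Require Import ring lra.

(* Projections summing to 1 in a C*-algebra are mutually orthogonal, so the
   unital *-homomorphisms from C^X to B are exactly the X-indexed families of
   projections of B with sum 1.  Hence C^*(H) is the colimit of the diagram with
   C^2 at each vertex v, C^e at each edge e, and, for v in e, the map C^2 -> C^e
   sending (1, 0) to the minimal projection of v.

   Conversely, a finite-dimensional commutative C*-algebra has a basis of minimal
   projections, and a morphism sends a minimal projection to the sum of a set S of
   minimal projections.  A cocone under a diagram is thus a family of projections
   with one partition of unity per object and one equation p = \sum_(l in S) q_l
   per arrow and minimal projection; the equation becomes the edge joining S to the
   complement of p in its own partition of unity.

   C^*(H) itself is the separated completion of the term algebra for the supremum
   of the seminorms of all representations; the uniqueness in its universal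
   property rests on the automatic continuity of *-homomorphisms.  Orthogonality
   and continuity are proved without spectral theory: a selfadjoint h of norm less
   than 1 is the real part of the unitary h + i sqrt (1 - h^2). *)

Set Implicit Arguments.
Unset Strict Implicit.
Unset Printing Implicit Defensive.

Import Order.TTheory GRing.Theory Num.Theory.
Import numFieldNormedType.Exports.

Local Open Scope ring_scope.
Local Open Scope complex_scope.

(** * Norms and limits *)

(* A [pzRingType], as [1 = 0] holds in the zero algebra. *)
HB.instance Definition _ (R : realType) (A : cstarAlgType R) :=
  GRing.Zmodule_isPzRing.Build (CStarAlgebra.sort A) (@cmulA R A) (@cmul1x R A)
    (@cmulx1 R A) (@cmulDl R A) (@cmulDr R A).

Section Norm.
Variables (R : realType) (A : cstarAlgType R).
Implicit Types (x y z : A) (k : R[i]) (r : R).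

Lemma cmulE x y : x ** y = x * y. Proof. by []. Qed.
Lemma coneE : cone = 1 :> A. Proof. by []. Qed.

Lemma mulZl k x y : (k *: x) * y = k *: (x * y). Proof. exact: cmulZl. Qed.
Lemma mulZr k x y : x * (k *: y) = k *: (x * y). Proof. exact: cmulZr. Qed.

Lemma star0 : star 0 = 0 :> A.
Proof. by rewrite -[X in star X](scale0r (0 : A)) starZ conjC0 scale0r. Qed.
Lemma starN x : star (- x) = - star x.
Proof. by apply/eqP; rewrite -subr_eq0 opprK -starD addNr star0. Qed.
Lemma starB x y : star (x - y) = star x - star y.
Proof. by rewrite starD starN. Qed.
Lemma starMr x y : star (x * y) = star y * star x. Proof. exact: starM. Qed.
Lemma star1 : star 1 = 1 :> A.
Proof. by rewrite -[LHS](mulr1 (star 1)) -{2}(starK 1) -starMr mulr1 starK. Qed.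
Lemma star_sum I (s : seq I) (P : pred I) (F : I -> A) :
  star (\sum_(i <- s | P i) F i) = \sum_(i <- s | P i) star (F i).
Proof. exact: (big_morph _ starD star0). Qed.
Lemma starZr r x : star (r%:C *: x) = r%:C *: star x.
Proof. by rewrite starZ; congr (_ *: _); exact: conjc_real. Qed.

(** Norms are nonnegative reals embedded in [R[i]]; the real-valued copy opens them to real
    arithmetic. *)
Definition nrm x : R := complex.Re `|x|.

Lemma normE x : `|x| = (nrm x)%:C.
Proof. by rewrite RRe_real // ger0_real. Qed.
Lemma nrm_ge0 x : 0 <= nrm x.
Proof. by rewrite -ler0c -normE. Qed.
Lemma nrm0_eq0 x : nrm x = 0 -> x = 0.
Proof. by move=> x0; apply/eqP; rewrite -normr_eq0 normE x0. Qed.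
Lemma nrm0 : nrm 0 = 0.
Proof. by rewrite /nrm normr0. Qed.
Lemma nrmD x y : nrm (x + y) <= nrm x + nrm y.
Proof. by rewrite -lecR rmorphD /= -!normE ler_normD. Qed.
Lemma nrmN x : nrm (- x) = nrm x.
Proof. by rewrite /nrm normrN. Qed.
Lemma nrmB x y : nrm (x - y) <= nrm x + nrm y.
Proof. by rewrite -(nrmN y) nrmD. Qed.
Lemma nrmC x y : nrm (x - y) = nrm (y - x).
Proof. by rewrite -nrmN opprB. Qed.
Lemma nrm_tri y x z : nrm (x - z) <= nrm (x - y) + nrm (y - z).
Proof. by rewrite -{1}(subrK y x) -addrA nrmD. Qed.
Lemma nrmZ k x : nrm (k *: x) = complex.Re `|k| * nrm x.
Proof.
apply: complexI; rewrite rmorphM /= -!normE normrZ.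
by congr (_ * _); rewrite RRe_real // ger0_real.
Qed.
Lemma nrmZr r x : nrm (r%:C *: x) = `|r| * nrm x.
Proof. by rewrite nrmZ normc_def /= expr0n addr0 sqrtr_sqr. Qed.
Lemma nrmM x y : nrm (x * y) <= nrm x * nrm y.
Proof. by rewrite -lecR rmorphM /= -!normE cstar_normM. Qed.
Lemma nrm_cstar x : nrm (star x * x) = nrm x ^+ 2.
Proof. by apply: complexI; rewrite rmorphXn /= -!normE; exact: cstar_identity. Qed.
(** From [|y|^2 = |star y * y| <= |star y| |y|], cancelling [|y|]; the converse is the same bound at
    [star x]. *)
Lemma nrm_star x : nrm (star x) = nrm x.
Proof.
suff le y : nrm y <= nrm (star y).
  by apply/eqP; rewrite eq_le le andbT; have := le (star x); rewrite starK.
have [y0|y0] := eqVneq (nrm y) 0; first by rewrite y0 nrm_ge0.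
have yp : 0 < nrm y by rewrite lt_def y0 nrm_ge0.
by rewrite -(ler_pM2r yp) -expr2 -nrm_cstar nrmM.
Qed.
Lemma nrm_le1 x : nrm x ^+ 2 <= nrm x -> nrm x <= 1.
Proof. by have := nrm_ge0 x; nra. Qed.
(** Equality fails in the zero algebra, where [1 = 0]. *)
Lemma nrm1_le : nrm 1 <= 1.
Proof. by apply: nrm_le1; rewrite -nrm_cstar star1 mulr1. Qed.
Lemma nrm_proj x : projection x -> nrm x <= 1.
Proof. by case=> xs xx; apply: nrm_le1; rewrite -nrm_cstar xs -cmulE xx. Qed.
Lemma nrm_sum I (s : seq I) (P : pred I) (F : I -> A) :
  nrm (\sum_(i <- s | P i) F i) <= \sum_(i <- s | P i) nrm (F i).
Proof.
elim/big_rec2: _ => [|i u v _ le]; first by rewrite nrm0.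
by rewrite (le_trans (nrmD _ _)) // lerD2l.
Qed.
Lemma nrm_eq0P x : (forall e, 0 < e -> nrm x <= e) -> x = 0.
Proof.
move=> h; apply: nrm0_eq0; apply/eqP; rewrite eq_le nrm_ge0 andbT.
by apply/ler_addgt0Pl => e e0; rewrite addr0 h.
Qed.
Lemma nrmX x n : nrm (x ^+ n.+1) <= nrm x ^+ n.+1.
Proof.
elim: n => [|n IH]; first by rewrite !expr1.
rewrite exprS [X in _ <= X]exprS (le_trans (nrmM _ _)) //.
by rewrite ler_wpM2l ?nrm_ge0.
Qed.

Definition tends (u : nat -> A) (l : A) :=
  forall e : R, 0 < e -> exists N, forall n, (N <= n)%N -> nrm (u n - l) <= e.

Definition vanishing (b : nat -> R) :=
  forall e : R, 0 < e -> exists N, forall n, (N <= n)%N -> b n <= e.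

Lemma tends_uniq u l l' : tends u l -> tends u l' -> l = l'.
Proof.
move=> ul ul'; apply/eqP; rewrite -subr_eq0; apply/eqP/nrm_eq0P => e e0.
have e20 : 0 < e / 2 by rewrite divr_gt0.
have [N hN] := ul _ e20; have [N' hN'] := ul' _ e20.
rewrite (splitr e) (le_trans (nrm_tri (u (maxn N N')) _ _)) // lerD //.
  by rewrite nrmC hN // leq_maxl.
by rewrite hN' // leq_maxr.
Qed.

Lemma tends_lip (u v : nat -> A) (l m : A) (c : R) : tends u l ->
  (forall n, nrm (v n - m) <= c * nrm (u n - l)) -> tends v m.
Proof.
move=> ul uv e e0.
(* The sign of [c] is unknown and [c] may be 0; [|c| + 1] is a positive upper bound. *)
have c0 : 0 < `|c| + 1 by rewrite ltr_wpDl.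
have [N hN] := ul _ (divr_gt0 e0 c0); exists N => n /hN.
rewrite ler_pdivlMr // => h; apply: le_trans (uv n) _; apply: le_trans h.
rewrite mulrC ler_wpM2l ?nrm_ge0 //.
by rewrite (le_trans (ler_norm _)) // lerDl.
Qed.

Lemma tendsMl x u l : tends u l -> tends (fun n => x * u n) (x * l).
Proof. by move/tends_lip; apply=> n; rewrite -mulrBr; exact: nrmM. Qed.
Lemma tendsMr x u l : tends u l -> tends (fun n => u n * x) (l * x).
Proof.
by move/tends_lip; apply=> n; rewrite -mulrBl mulrC; exact: nrmM.
Qed.
Lemma tends_star u l : tends u l -> tends (fun n => star (u n)) (star l).
Proof.
move/tends_lip; apply=> n; rewrite -starB nrm_star -[X in X <= _]mul1r.
exact: lexx.
Qed.
Lemma tends_shift u l : tends u l -> tends (fun n => u n.+1) l.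
Proof. by move=> ul e /ul[N h]; exists N => n /leqW/h. Qed.
Lemma tends_nrm_le u l c : tends u l -> (forall n, nrm (u n) <= c) -> nrm l <= c.
Proof.
move=> ul uc; apply/ler_addgt0Pl => e e0; have [N hN] := ul _ e0.
rewrite -(subKr (u N) l) (le_trans (nrmB _ _)) // addrC lerD // hN //.
Qed.

(** Carries completeness from filters to sequences with an explicit modulus [b]. *)
Lemma cauchy_tends (u : nat -> A) (b : nat -> R) : vanishing b ->
  (forall n m : nat, nrm (u (n + m)%N - u n) <= b n) -> exists l, tends u l.
Proof.
move=> bv ub.
have ucvg : cvg (u @ \oo)%classic.
  apply: cauchy_cvg; apply/cauchyP => e e0.
  have eE : e = (complex.Re e)%:C by rewrite RRe_real // ger0_real // ltW.
  have e20 : 0 < complex.Re e / 2.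
    by rewrite divr_gt0 // -ltcR -eE.
  have [N hN] := bv _ e20.
  exists (u N); exists N => // n /= nN.
  rewrite -ball_normE /ball_ /= normE nrmC eE ltcR -(subnKC nN).
  rewrite (le_lt_trans (ub _ _)) // (le_lt_trans (hN _ (leqnn N))) //.
  by rewrite ltr_pdivrMr // ltr_pMr ?ltr1n // -ltcR -eE.
exists (lim (u @ \oo)%classic) => e e0.
move/cvgrPdist_le: ucvg => /(_ e%:C); rewrite ltcR => /(_ e0)[N _ h].
by exists N => n /h; rewrite normE lecR nrmC.
Qed.

End Norm.

(** * Square roots and automatic continuity *)

Section SquareRoot.
Variables (R : realType) (A : cstarAlgType R).
Implicit Types (x y z a b h p q : A) (r : R).

Lemma vanishing_geometric r : 0 <= r -> r < 1 -> vanishing (fun n => r ^+ n).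
Proof.
move=> r0 r1 e e0; have r1' : `|r| < 1 by rewrite ger0_norm.
have /cvgr0Pnorm_le/(_ _ e0)[N _ hN] := cvg_expr r1'.
by exists N => n /hN; apply: le_trans; rewrite ler_norm.
Qed.

Lemma half_dbl x : (2^-1 : R)%:C *: (x + x) = x.
Proof. by rewrite -mulr2n -scalerMnr scalerMnl -rmorphMn /= -mulr_natr mulVf // scale1r. Qed.

(* The solution [z] of [z = (a + z^2) / 2] is the limit of its Picard iterates;
   then [1 - z] is a square root of [1 - a]. *)
Lemma selfadjoint_sqrt a r : 0 <= r -> r < 1 -> star a = a ->
    nrm a <= 1 - (1 - r) ^+ 2 ->
  exists y, [/\ star y = y, forall x, x * a = a * x -> x * y = y * x
              & y * y = 1 - a].
Proof.
move=> r0 r1 sa na; pose g z := (2^-1 : R)%:C *: (a + z * z).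
pose z n := iter n g 0.
have zS n : z n.+1 = g (z n) by [].
have half0 : 0 <= (2^-1 : R) by rewrite invr_ge0.
(* [1 - (1 - r)^2 + r^2 = 2 r], so [g] preserves the ball of radius [r]. *)
have g_bound u : nrm u <= r -> nrm (g u) <= r.
  move=> ur; rewrite nrmZr ger0_norm //.
  have := nrmD a (u * u); have := nrmM u u; have := nrm_ge0 u; nra.
(* [u^2 - v^2] has norm at most [2 r |u - v|]; the half in [g] leaves the factor [r]. *)
have g_contr u v : nrm u <= r -> nrm v <= r ->
    nrm (g u - g v) <= r * nrm (u - v).
  move=> ur vr; rewrite -scalerBr nrmZr ger0_norm // opprD addrACA subrr add0r.
  have -> : u * u - v * v = u * (u - v) + (u - v) * v.
    by rewrite mulrBr mulrBl addrA subrK.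
  have := nrmD (u * (u - v)) ((u - v) * v).
  have := nrmM u (u - v); have := nrmM (u - v) v.
  have := nrm_ge0 u; have := nrm_ge0 v; have := nrm_ge0 (u - v); nra.
have z_bound n : nrm (z n) <= r.
  by elim: n => [|n IH]; rewrite ?zS ?g_bound // /z /= nrm0.
have z_cauchy n m : nrm (z (n + m)%N - z n) <= r ^+ n.
  elim: n => [|n IH]; first by rewrite subr0 expr0 (le_trans (z_bound _)) ?ltW.
  rewrite addSn !zS exprS (le_trans (g_contr _ _ _ _)) //.
  by rewrite ler_wpM2l.
have [l zl] := cauchy_tends (vanishing_geometric r0 r1) z_cauchy.
have l_bound : nrm l <= r := tends_nrm_le zl z_bound.
have gl : l = g l.
  apply: (tends_uniq (tends_shift zl)); apply: tends_lip zl _ => n.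
  by rewrite zS; apply: g_contr.
have sl : star l = l.
  apply: (tends_uniq (tends_star zl)) => e /zl[N hN]; exists N => n /hN.
  suff -> : star (z n) = z n by [].
  elim: n => [|n IH]; first by rewrite /z /= star0.
  by rewrite zS /g starZr starD sa starMr IH.
have cl x : x * a = a * x -> x * l = l * x.
  move=> xa; apply: (tends_uniq (tendsMl x zl)).
  move=> e /(tendsMr x zl)[N hN]; exists N => n /hN.
  suff -> : x * z n = z n * x by [].
  elim: n => [|n IH]; first by rewrite /z /= mulr0 mul0r.
  by rewrite zS /g mulZr mulZl mulrDr mulrDl xa -mulrA -IH !mulrA IH.
exists (1 - l); split.
- by rewrite starB star1 sl.
- by move=> x xa; rewrite mulrBr mulrBl mulr1 mul1r cl.
- have : l + l = a + l * l by rewrite {1 2}gl -scalerDr half_dbl.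
  move=> ll; rewrite mulrBr mulrBl mulr1 mul1r mulrBl mul1r.
  by rewrite -addrA -opprD addrA ll addrK.
Qed.

(* [star z * z = h^2 + y^2] for [z = h + i y], and [h = (z + star z) / 2]. *)
Lemma nrm_sqr_le h y : star h = h -> star y = y -> h * y = y * h ->
  nrm h ^+ 2 <= nrm (h * h + y * y).
Proof.
move=> sh sy hy; pose z := h + 'i%C *: y.
have sz : star z = h - 'i%C *: y.
  rewrite starD starZ sh sy -scaleNr; congr (_ + _ *: _).
  by apply/eqP; rewrite eq_complex /= oppr0 !eqxx.
have zz : star z * z = h * h + y * y.
  rewrite sz /z mulrBl !mulrDr !mulZl !mulZr hy scalerA.
  have -> : 'i%C * 'i%C = -1 :> R[i] by rewrite -expr2 sqr_i.
  by rewrite scaleN1r opprD opprK addrA addrK.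
rewrite -zz nrm_cstar lerXn2r ?nnegrE ?nrm_ge0 //.
have -> : h = (2^-1 : R)%:C *: (z + star z).
  by rewrite sz /z addrACA subrr addr0 half_dbl.
rewrite nrmZr ger0_norm ?invr_ge0 //.
have := nrmD z (star z); rewrite nrm_star; lra.
Qed.

End SquareRoot.

Section Continuity.
Variables (R : realType) (A B : cstarAlgType R) (f : starMorphism A B).

Lemma star_morphMr x y : f (x * y) = f x * f y. Proof. exact: star_morphM. Qed.
Lemma star_morph1r : f 1 = 1. Proof. exact: star_morph1. Qed.

(* For small [h], the element [u = h + i sqrt (1 - h^2)] is unitary, hence so is
   its image, and [f h] is the real part of [f u]. *)
Lemma star_morph_selfadjoint_le h : star h = h -> nrm (f h) <= 2 * nrm h.
Proof.
have small k : star k = k -> nrm k <= 2^-1 -> nrm (f k) <= 1.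
  move=> sk nk; have k0 := nrm_ge0 k.
  (* [|k^2| <= 1/4] lies below [1 - (1 - 1/2)^2 = 3/4]. *)
  have [||||y [sy cy yy]] := @selfadjoint_sqrt _ A (k * k) 2^-1.
  - by rewrite invr_ge0.
  - by rewrite invf_lt1 // ltr1n.
  - by rewrite starMr sk.
  - by have := nrmM k k; nra.
  have ky : k * y = y * k by apply: cy; rewrite mulrA.
  have f0 := nrm_ge0 (f k).
  rewrite -(@expr_le1 _ 2) // (le_trans (@nrm_sqr_le _ _ _ (f y) _ _ _)) //.
  - by rewrite -star_morph_star sk.
  - by rewrite -star_morph_star sy.
  - by rewrite -!star_morphMr ky.
  - by rewrite -!star_morphMr -linearD /= yy addrC subrK star_morph1r nrm1_le.
(* Dividing by [e + 2 |h|] brings the norm to at most 1/2; [e] keeps the divisor positive when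
   [h = 0]. *)
move=> sh; apply/ler_addgt0Pl => e e0.
have n0 : 0 < e + 2 * nrm h by have := nrm_ge0 h; nra.
have := small ((e + 2 * nrm h)^-1%:C *: h).
rewrite starZr sh linearZ /= !nrmZr ger0_norm ?invr_ge0 ?(ltW n0) //.
rewrite ![(e + _)^-1 * _]mulrC !ler_pdivrMr // mul1r; apply=> //.
by rewrite mulrDr mulrA mulVf // mul1r lerDr mulr_ge0 ?invr_ge0 ?(ltW e0).
Qed.

(** The C*-identity reduces the bound to the selfadjoint element [star x * x]. The constant is not
    sharp, but any constant gives continuity. *)
Lemma star_morph_bounded x : nrm (f x) <= 2 * nrm x.
Proof.
have := @star_morph_selfadjoint_le (star x * x).
rewrite starMr starK star_morphMr star_morph_star !nrm_cstar => /(_ erefl).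
have := nrm_ge0 x; have := nrm_ge0 (f x); nra.
Qed.

End Continuity.

(** * Projections with sum 1 *)

Section Projections.
Variables (R : realType) (A : cstarAlgType R).
Implicit Types (x y z a b c p q : A) (r : R).

(* With [2 s^2 = 2 + b^2] one has [(1 + b^2)^2 = 1 + 2 (bs)^2].  For [r < 1] there
   is a selfadjoint [w] with [w^2 + r^2 (1 + b^2)^2 = 1], so that
   [w^2 + 2 r^2 (bs)^2 = 1 - r^2] and [r^2 |bs|^2 <= 1 - r^2].  Letting [r] tend to
   1 gives [bs = 0], and then [b (2 + b^2) = 0]. *)
Lemma sqr_zero_of_bound b : star b = b -> nrm b <= 2^-1 ->
  nrm (1 + b * b) <= 1 -> b = 0.
Proof.
move=> sb nb nbb; have b0 := nrm_ge0 b.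
have half1 : 2^-1 < 1 :> R by rewrite invf_lt1 // ltr1n.
have [||||s [ss cs sE]] := @selfadjoint_sqrt _ A (- ((2^-1 : R)%:C *: (b * b))) 2^-1.
- by rewrite invr_ge0.
- by [].
- by rewrite starN starZr starMr sb.
- by rewrite nrmN nrmZr ger0_norm ?invr_ge0 //; have := nrmM b b; nra.
have bs : b * s = s * b.
  by apply: cs; rewrite mulrN mulNr mulZr mulZl mulrA.
have sE2 : s * s + s * s = 1 + 1 + b * b.
  by rewrite sE opprK addrACA -scalerDr half_dbl.
(* The factor [sqrt 2] will make the square of [h] equal to [2 r^2 (bs)^2]. *)
pose t := (Num.sqrt 2 : R); have t2 : t * t = 2 by rewrite -expr2 sqr_sqrtr.
have bst : star (b * s) = b * s by rewrite starMr sb ss bs.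
have key r : 0 <= r -> r < 1 -> (r * nrm (b * s)) ^+ 2 <= 1 - r ^+ 2.
  move=> r0 r1; pose T := r%:C *: (1 + b * b).
  have sT : star T = T by rewrite starZr starD star1 starMr sb.
  have nT : nrm T <= r by rewrite nrmZr ger0_norm // ler_piMr.
  (* [|T^2| <= r^2 <= 1 - (1 - r)^2], because [0 <= r < 1]. *)
  have [||||w [sw cw wE]] := @selfadjoint_sqrt _ A (T * T) r.
  - by [].
  - by [].
  - by rewrite starMr sT.
  - by have := nrmM T T; have := nrm_ge0 T; nra.
  pose h := (r * t)%:C *: (b * s).
  have bT : b * T = T * b by rewrite mulZr mulZl mulrDr mulrDl mulr1 mul1r mulrA.
  have sT' : s * T = T * s.
    by rewrite mulZr mulZl mulrDr mulrDl mulr1 mul1r mulrA -bs -!mulrA bs.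
  have bsT : (b * s) * (T * T) = (T * T) * (b * s).
    have bsTc : b * s * T = T * (b * s) by rewrite -mulrA sT' mulrA bT -mulrA.
    by rewrite mulrA bsTc -mulrA bsTc mulrA.
  have hT : h * w = w * h by rewrite mulZl mulZr cw.
  have sh : star h = h by rewrite starZr bst.
  have hhww : h * h + w * w = (1 - r ^+ 2)%:C *: (1 : A).
    have bsbs : b * s * (b * s) + b * s * (b * s) = b * b + b * b + b * b * (b * b).
      have -> : b * s * (b * s) = b * b * (s * s).
        by rewrite -mulrA (mulrA s) -bs !mulrA.
      by rewrite -mulrDr sE2 !mulrDr !mulr1.
    rewrite wE; have -> : h * h = (r ^+ 2)%:C *: (b * b + b * b + b * b * (b * b)).
      rewrite /h mulZl mulZr scalerA -rmorphM /= -bsbs -mulr2n -scalerMnr scalerMnl.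
      by rewrite -rmorphMn /=; congr (_%:C *: _); rewrite mulrACA t2 expr2 mulr_natr.
    have -> : T * T = (r ^+ 2)%:C *: (1 + (b * b + b * b + b * b * (b * b))).
      rewrite /T mulZl mulZr scalerA -rmorphM /= -expr2; congr (_ *: _).
      by rewrite mulrDr mulr1 mulrDl mul1r !addrA.
    rewrite addrCA -scalerBr opprD addrCA subrr addr0 scalerN.
    by rewrite rmorphB /= rmorph1 scalerBl scale1r.
  have := @nrm_sqr_le _ _ _ _ sh sw hT.
  have r2 : 0 <= 1 - r ^+ 2 by nra.
  rewrite hhww !nrmZr [`|1 - _|]ger0_norm // ger0_norm ?mulr_ge0 ?sqrtr_ge0 //.
  have := nrm1_le A; have := nrm_ge0 (b * s); have : 0 <= t := sqrtr_ge0 _.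
  rewrite mulrAC exprMn [t ^+ 2]expr2 t2.
  have := nrm_ge0 (1 : A); have := sqr_ge0 (r * nrm (b * s)); nra.
have bs0 : b * s = 0.
  apply: nrm0_eq0; apply/eqP; rewrite eq_le nrm_ge0 andbT leNgt; apply/negP.
  set N := nrm _ in key * => N0.
  have N1 : 0 < 1 + N ^+ 2 by nra.
  (* At [r = 1 - d], [key] gives [(1 - d)^2 N^2 <= 2 d < N^2 / 2], whereas [d <= 1/4] makes the left
     side at least [9/16 N^2]. *)
  pose d := N ^+ 2 / (4 * (1 + N ^+ 2)).
  have dE : d * (4 * (1 + N ^+ 2)) = N ^+ 2.
    by rewrite divfK // mulf_neq0 // gt_eqF.
  have d0 : 0 < d by nra.
  have d1 : d < 1 by nra.
  have := key (1 - d); rewrite exprMn; nra.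
have : b * (s * s + s * s) = 0 by rewrite mulrDr mulrA bs0 mul0r addr0.
rewrite sE2 !mulrDr mulr1 => /eqP; rewrite addr_eq0 => /eqP bb.
(* [b + b = - b^3], while [|b|^3 <= |b| / 4] since [|b| <= 1/2]; so [b] vanishes. *)
have : nrm (b + b) = 2 * nrm b.
  by rewrite -mulr2n -scaler_nat -(rmorph_nat (real_complex R)) nrmZr ger0_norm.
rewrite bb nrmN => bE; apply: nrm0_eq0.
have := nrmM b (b * b); have := nrmM b b; nra.
Qed.

(** The unit is an extreme point of the unit ball along selfadjoint directions. With [c = b / 2],
    the element [1 + c^2] is the average of the squares of the contractions [1 + c] and [1 - c], so
    [sqr_zero_of_bound] applies to [c]. *)
Lemma scalar_extremal b : star b = b -> nrm (1 + b) <= 1 -> nrm (1 - b) <= 1 ->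
  b = 0.
Proof.
move=> sb n1 n2; pose c := (2^-1 : R)%:C *: b.
have half0 : 0 <= (2^-1 : R) by rewrite invr_ge0.
have sc : star c = c by rewrite starZr sb.
have nhalf x y : nrm x <= 1 -> nrm y <= 1 -> nrm ((2^-1 : R)%:C *: (x + y)) <= 1.
  by move=> nx ny; rewrite nrmZr ger0_norm //; have := nrmD x y; lra.
have nb : nrm b <= 1.
  have -> : b = (2^-1 : R)%:C *: ((1 + b) + - (1 - b)).
    by rewrite opprB [b - 1]addrC addrACA subrr add0r half_dbl.
  by rewrite nhalf // nrmN.
have n3 : nrm (1 + c) <= 1.
  have -> : 1 + c = (2^-1 : R)%:C *: (1 + (1 + b)).
    by rewrite addrA scalerDr half_dbl.
  by rewrite nhalf // nrm1_le.
have n4 : nrm (1 - c) <= 1.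
  have -> : 1 - c = (2^-1 : R)%:C *: (1 + (1 - b)).
    by rewrite addrA scalerBr half_dbl.
  by rewrite nhalf // nrm1_le.
suff c0 : c = 0.
  by rewrite -(half_dbl b) scalerDr -/c c0 addr0.
apply: sqr_zero_of_bound => //.
  by rewrite nrmZr ger0_norm //; lra.
have -> : 1 + c * c = (2^-1 : R)%:C *: ((1 + c) * (1 + c) + (1 - c) * (1 - c)).
  rewrite !mulrDr !mulrDl !mulr1 !mul1r mulrNN.
  (* The reordering pairs each cross term with its opposite. *)
  rewrite (AC ((2*2)*(2*2)) (((1*4)*(5*8))*((2*6)*(3*7)))) /= !subrr !addr0.
  by rewrite half_dbl.
have sq x : nrm x <= 1 -> nrm (x * x) <= 1.
  by move=> nx; have := nrmM x x; have := nrm_ge0 x; nra.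
by apply: nhalf; apply: sq.
Qed.

Lemma projection1B p : projection p -> projection (1 - p).
Proof.
case=> sp pp; split; first by rewrite starB star1 sp.
by rewrite cmulE mulrBr mulr1 mulrBl mul1r -cmulE pp subrr subr0.
Qed.

(** Powers of [c] are selfadjoint, so by the C*-identity each squaring squares the norm. This stands
    in for the spectral radius formula. *)
Lemma nrm_expr2n c k : star c = c -> nrm (c ^+ (2 ^ k)) = nrm c ^+ (2 ^ k).
Proof.
move=> sc.
have sX n : star (c ^+ n) = c ^+ n.
  elim: n => [|n IH]; first by rewrite !expr0 star1.
  by rewrite {1}exprS starMr IH sc -exprSr.
elim: k => [|k IH]; first by rewrite expn0 !expr1.
by rewrite expnSr !exprM -IH -nrm_cstar sX expr2.
Qed.

(* [1 - pqp = (1 - p) + s] with [s = p (1 - q) p] orthogonal to [1 - p], so its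
   powers [(1 - p) + s^n] stay bounded by [2]. *)
Lemma nrm_compression_le p q : projection p -> projection q ->
  nrm (1 - p * q * p) <= 1.
Proof.
move=> Pp Pq; set c := 1 - _; have [sp pp] := Pp; have [sq qq] := Pq.
rewrite !cmulE in pp qq; pose s := p * (1 - q) * p.
have cE : c = (1 - p) + s.
  by rewrite /s mulrBr mulr1 mulrBl pp addrA subrK.
have sc : star c = c by rewrite starB star1 !starMr sp sq mulrA.
have ns : nrm s <= 1.
  have := nrm_proj Pp; have := nrm_proj (projection1B Pq).
  have := nrmM (p * (1 - q)) p; have := nrmM p (1 - q).
  have := nrm_ge0 p; have := nrm_ge0 (1 - q); have := nrm_ge0 (p * (1 - q)).
  rewrite -/s; nra.
have p1s : (1 - p) * s = 0.
  by rewrite /s !mulrA mulrBl mul1r pp subrr !mul0r.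
have sp1 : s * (1 - p) = 0.
  by rewrite /s -mulrA [p * (1 - p)]mulrBr mulr1 pp subrr mulr0.
have cX n : c ^+ n.+1 = (1 - p) + s ^+ n.+1.
  elim: n => [|n IH]; first by rewrite !expr1.
  rewrite exprSr IH cE mulrDl [(1 - p) * _]mulrDr [s ^+ _ * _]mulrDr p1s addr0.
  have -> : s ^+ n.+1 * (1 - p) = 0 by rewrite exprSr -mulrA sp1 mulr0.
  rewrite add0r -exprSr.
  by have [_] := projection1B Pp; rewrite cmulE => ->.
have cb k : nrm c ^+ (2 ^ k) <= 2.
  rewrite -nrm_expr2n // -(prednK (expn_gt0 2 k)) cX (le_trans (nrmD _ _)) //.
  rewrite (_ : 2 = 1 + 1) // lerD //; first exact/nrm_proj/projection1B.
  by rewrite (le_trans (nrmX _ _)) // exprn_ile1 // nrm_ge0.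
rewrite leNgt; apply/negP => c1.
have c0 : 0 < nrm c := lt_trans ltr01 c1.
(* If [|c| > 1], some power [|c|^(2^N)] is at least 3, against the bound 2. *)
have [|||N] := @vanishing_geometric R (nrm c)^-1 _ _ (3^-1) _.
- by rewrite invr_ge0 ltW.
- by rewrite invf_lt1.
- by rewrite invr_gt0.
move=> /(_ _ (ltnW (ltn_expl N (isT : (1 < 2)%N)))).
rewrite exprVn lef_pV2 ?posrE ?exprn_gt0 //; have := cb N; lra.
Qed.

(* The compressions [a i = p_w p_i p_w], [i <> w], sum to 0, so both [1 + a_u / m]
   and [1 - a_u / m] are averages of the contractions [1] and [1 - a i]. *)
Lemma projections_sum1_orth (I : finType) (P : pred I) (p : I -> A) :
    (forall i, P i -> projection (p i)) -> \sum_(i | P i) p i = 1 ->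
  forall i j, P i -> P j -> i != j -> p i * p j = 0.
Proof.
move=> Pp sum1 u w Pu Pw uw; pose a i := p w * p i * p w.
pose S := [pred i | P i && (i != w)].
have a_sum : \sum_(i in S) a i = 0.
  have : \sum_(i | P i) a i = p w by
    rewrite -mulr_suml -mulr_sumr sum1 mulr1; case: (Pp _ Pw).
  rewrite (bigD1 w) //= /a.
  have [_ ww] := Pp _ Pw; rewrite cmulE in ww; rewrite !ww => /eqP.
  by rewrite -subr_eq0 addrAC subrr add0r => /eqP.
have Su : u \in S by rewrite inE Pu.
have na i : i \in S -> nrm (1 - a i) <= 1.
  by case/andP=> Pi _; apply: nrm_compression_le; exact: Pp.
pose m := #|S|; have m0 : 0 < (m%:R : R).
  by rewrite ltr0n; apply/card_gt0P; exists u.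
have sum_le (F : I -> A) : (forall i, i \in S -> nrm (F i) <= 1) ->
    nrm (\sum_(i in S) F i) <= m%:R.
  move=> Fle; rewrite (le_trans (nrm_sum _ _ _)) //.
  by rewrite -sumr_const ler_sum.
have mE : \sum_(i in S) 1 = (m%:R : R)%:C *: (1 : A).
  by rewrite sumr_const rmorph_nat scaler_nat.
pose b := (m%:R^-1 : R)%:C *: a u.
have nb (F : I -> A) x : (forall i, i \in S -> nrm (F i) <= 1) ->
    \sum_(i in S) F i = (m%:R : R)%:C *: x -> nrm x <= 1.
  move=> /sum_le Fle FE; move: Fle; rewrite FE nrmZr ger0_norm ?(ltW m0) //.
  by rewrite ger_pMr.
have mb : (m%:R : R)%:C *: b = a u.
  by rewrite scalerA -rmorphM /= divff ?gt_eqF // scale1r.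
have sb : star b = b.
  have [[sw _] [su _]] := (Pp _ Pw, Pp _ Pu).
  by rewrite starZr !starMr sw su mulrA.
have b0 : b = 0.
  apply: scalar_extremal => //.
  (* As the [a i] sum to 0, leaving out the one at [u] makes the total [m + a u]. *)
  - apply: (nb (fun i => if i == u then 1 else 1 - a i)) => [i Si|].
      by case: ifP => _; [exact: nrm1_le|exact: na].
    rewrite scalerDr mb -mE.
    transitivity (\sum_(i in S) (1 - a i + (if i == u then a u else 0))).
      by apply: eq_bigr => i _; case: eqP => [->|_]; rewrite ?subrK ?addr0.
    rewrite big_split /= sumrB a_sum subr0 -big_mkcondr /=; congr (_ + _).
    rewrite (big_pred1 u) // => i; apply/andP/eqP => [[_ /eqP]|->] //; split.
  - apply: (nb (fun i => if i == u then 1 - a u else 1)) => [i Si|].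
      by case: ifP => _; [exact: na|exact: nrm1_le].
    rewrite scalerBr mb -mE.
    transitivity (\sum_(i in S) (1 - (if i == u then a u else 0))).
      by apply: eq_bigr => i _; case: ifP; rewrite ?subr0.
    rewrite sumrB -big_mkcondr /=; congr (_ - _).
    rewrite (big_pred1 u) // => i; apply/andP/eqP => [[_ /eqP]|->] //; split.
have au0 : a u = 0 by rewrite -mb b0 scaler0.
(* [a u] is [star z * z] for [z = p u * p w]. *)
have : nrm (p u * p w) ^+ 2 = 0.
  have [[sw _] [su uu]] := (Pp _ Pw, Pp _ Pu); rewrite cmulE in uu.
  by rewrite -nrm_cstar starMr sw su mulrA -[p w * _ * _]mulrA uu -/(a u) au0 nrm0.
by move/eqP; rewrite expf_eq0 /= => /eqP/nrm0_eq0.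
Qed.
End Projections.

(** * Finite-dimensional commutative C*-algebras *)

Section AtomicBases.
Variables (R : realType).
Implicit Types (A B : cstarAlgType R).

Definition partition_of_unity A (X : finType) (e : X -> A) :=
  [/\ forall i, projection (e i), forall i j, i != j -> e i * e j = 0
    & \sum_i e i = 1].

(** Such an [e] identifies [A] with [C^X]: nonzero orthogonal projections are linearly
    independent. *)
Definition atomic_basis A (X : finType) (e : X -> A) :=
  [/\ partition_of_unity e, forall i, e i <> 0
    & forall x, exists k : X -> R[i], x = \sum_i k i *: e i].

Lemma make_starMorphism A B (f : A -> B) : linear f -> f 1 = 1 ->
    (forall x y, f (x * y) = f x * f y) -> (forall x, f (star x) = star (f x)) ->
  exists g : starMorphism A B, g =1 f.
Proof.
move=> fL f1 fM fS.
pose mL := GRing.isLinear.Build R[i] A B *:%R f fL.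
pose mS := isStarMorphism.Build R A B f f1 fM fS.
pose g : starMorphism A B := HB.pack f mL mS.
by exists g.
Qed.

Lemma sum_projections_partition A (X : finType) (e : X -> A) :
    (forall i, projection (e i)) -> \sum_i e i = 1 -> partition_of_unity e.
Proof.
move=> pe e1; split => // i j ij.
exact: (@projections_sum1_orth _ _ _ predT e).
Qed.

Lemma partition_mulr A (X : finType) (e : X -> A) (k : X -> R[i]) i :
  partition_of_unity e -> (\sum_j k j *: e j) * e i = k i *: e i.
Proof.
case=> pe oe _; rewrite mulr_suml (bigD1 i) //= big1 => [|j ji].
  by rewrite addr0 mulZl; case: (pe i) => _; rewrite cmulE => ->.
by rewrite mulZl oe // scaler0.
Qed.

Lemma partition_mul A (X : finType) (e : X -> A) (k l : X -> R[i]) :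
  partition_of_unity e ->
  (\sum_i k i *: e i) * (\sum_i l i *: e i) = \sum_i (k i * l i) *: e i.
Proof.
move=> pe; rewrite mulr_sumr; apply: eq_bigr => i _.
by rewrite mulZr partition_mulr // scalerA mulrC.
Qed.

Lemma partition_star A (X : finType) (e : X -> A) (k : X -> R[i]) :
  partition_of_unity e -> star (\sum_i k i *: e i) = \sum_i (k i)^* *: e i.
Proof.
case=> pe _ _; rewrite star_sum; apply: eq_bigr => i _.
by rewrite starZ; case: (pe i) => ->.
Qed.

Lemma atomic_basis_inj A (X : finType) (e : X -> A) (k l : X -> R[i]) :
  atomic_basis e -> \sum_i k i *: e i = \sum_i l i *: e i -> k =1 l.
Proof.
move=> [pe e0 _] kl i.
have /eqP : k i *: e i = l i *: e i by rewrite -!partition_mulr // kl.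
rewrite -subr_eq0 -scalerBl scaler_eq0 subr_eq0 => /orP[/eqP //|/eqP].
by move/e0.
Qed.

(** The map is [\sum_i k i *: e i |-> \sum_i k i *: q i]. Coordinates are picked by choice; their
    uniqueness turns each operation into the pointwise one on coordinates. *)
Lemma atomic_basis_morphism A B (X : finType) (e : X -> A) (q : X -> B) :
    atomic_basis e -> partition_of_unity q ->
  exists f : starMorphism A B, forall i, f (e i) = q i.
Proof.
move=> be pq; have [pe e0 espan] := be; have [_ _ e1] := pe.
pose k x := projT1 (cid (espan x)).
have kE x : x = \sum_i k x i *: e i by rewrite /k; case: cid.
have kP x l : x = \sum_i l i *: e i -> k x =1 l.
  by move=> xl; apply: (atomic_basis_inj be); rewrite -kE.
have := @make_starMorphism A B (fun x => \sum_i k x i *: q i).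
case=> [a x y||x y|x|f fE].
- rewrite scaler_sumr -big_split /=; apply: eq_bigr => i _.
  rewrite scalerA -scalerDl; congr (_ *: _).
  apply: (kP _ (fun i => a * k x i + k y i)).
  rewrite {1}(kE x) {1}(kE y) scaler_sumr -big_split /=.
  by apply: eq_bigr => j _; rewrite scalerA -scalerDl.
- have [_ _ <-] := pq; apply: eq_bigr => i _.
  rewrite (kP _ (fun=> 1)) ?scale1r // -e1.
  by apply: eq_bigr => j _; rewrite scale1r.
- rewrite partition_mul //; apply: eq_bigr => i _; congr (_ *: _).
  apply: (kP _ (fun i => k x i * k y i)).
  by rewrite -partition_mul // -!kE.
- rewrite partition_star //; apply: eq_bigr => i _; congr (_ *: _).
  apply: (kP _ (fun i => (k x i)^*)).
  by rewrite -partition_star // -!kE.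
exists f => i; rewrite fE (bigD1 i) //= big1 => [|j ji].
  rewrite addr0 (kP _ (fun j => (j == i)%:R)) ?eqxx ?scale1r //.
  rewrite (bigD1 i) //= big1 => [|j /negPf ->]; rewrite ?scale0r //.
  by rewrite eqxx scale1r addr0.
rewrite (kP _ (fun j => (j == i)%:R)) ?(negPf ji) ?scale0r //.
rewrite (bigD1 i) //= big1 => [|l /negPf ->]; rewrite ?scale0r //.
by rewrite eqxx scale1r addr0.
Qed.

Lemma atomic_basis_morphism_eq A B (X : finType) (e : X -> A)
    (f g : starMorphism A B) :
  atomic_basis e -> (forall i, f (e i) = g (e i)) -> f = g.
Proof.
move=> [_ _ espan] fg; apply: starMorphism_eq => x; have [k ->] := espan x.
by rewrite !linear_sum; apply: eq_bigr => i _; rewrite !linearZ /= fg.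
Qed.

Lemma morphism_partition A B (X : finType) (e : X -> A) (f : starMorphism A B) :
  partition_of_unity e -> partition_of_unity (f \o e).
Proof.
case=> pe oe e1; split => [i|i j ij|] /=.
- by case: (pe i) => si ii; split; rewrite -?star_morph_star -?star_morphM ?si ?ii.
- by rewrite -star_morphMr oe // linear0.
- by rewrite -(star_morph1r f) -e1 linear_sum.
Qed.

End AtomicBases.

(** * Simultaneous diagonalization in the commutative case *)

Section CommutativeFiniteDimensional.
Variables (R : realType) (A : cstarAlgType R).
Hypothesis mulC : commutative_cstar A.
Implicit Types (x y z e : A).

Lemma cmulrC x y : x * y = y * x. Proof. exact: mulC. Qed.

(** By commutativity [star x * x] is nilpotent too, and it is selfadjoint, so [nrm_expr2n] makes its
    norm vanish. *)
Lemma nilpotent_eq0 x n : x ^+ n = 0 -> x = 0.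
Proof.
move=> xn; have comm : GRing.comm (star x) x by exact: cmulrC.
have : nrm (star x * x) ^+ (2 ^ n) = 0.
  rewrite -nrm_expr2n ?starMr ?starK // exprMn_comm //.
  by rewrite -(subnK (ltnW (ltn_expl n (isT : (1 < 2)%N)))) [x ^+ _]exprD xn
    mulr0 mulr0 nrm0.
by move/eqP; rewrite expf_eq0 expn_gt0 /= nrm_cstar expf_eq0 /= => /eqP/nrm0_eq0.
Qed.

(** For [f = e * (1 - star e)], the product [star f * f] contains the factor [(1 - e) * e = 0].
    Hence [e = e * star e], which is selfadjoint. *)
Lemma idempotent_projection e : e * e = e -> projection e.
Proof.
move=> ee; split => //; pose f := e * (1 - star e).
have f0 : f = 0.
  apply: nrm0_eq0; apply/eqP; rewrite -sqrf_eq0 -nrm_cstar.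
  rewrite /f starMr starB star1 starK [(1 - e) * _]cmulrC -mulrA [(1 - e) * _]mulrA.
  by rewrite mulrBl mul1r ee subrr mul0r mulr0 nrm0.
have : e = e * star e by apply/eqP; rewrite -subr_eq0 -{1}(mulr1 e) -mulrBr -/f f0.
by move=> eE; rewrite {1}eE starMr starK -eE.
Qed.

(** Evaluation at [x] of the monic polynomial with roots [s]; the strict bound leaves room for its
    leading coefficient. *)
Lemma prod_linear_factors x (s : seq R[i]) n : (size s < n)%N ->
  \sum_(i < n) (\prod_(a <- s) ('X - a%:P))`_i *: x ^+ i
    = \prod_(a <- s) (x - a *: (1 : A)).
Proof.
elim: s n => [|a s IH] [//|n] /= sn.
  rewrite !big_nil big_ord_recl coef1 /= scale1r expr0 big1 ?addr0 // => i _.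
  by rewrite coef1 scale0r.
rewrite !big_cons mulrC; set p := \prod_(_ <- s) _; set y := \prod_(_ <- s) _.
under eq_bigr do rewrite mulrBr coefB coefMX coefMC scalerBl.
rewrite sumrB big_ord_recl /= scale0r add0r mulrBl; congr (_ - _).
  rewrite /y -(IH n) // mulr_sumr; apply: eq_bigr => i _.
  by rewrite mulZr -exprS.
rewrite mulZl mul1r /y -(IH n.+1) ?(ltnW sn) // scaler_sumr.
by apply: eq_bigr => i _; rewrite scalerA mulrC.
Qed.

(** The [n.+1] first powers of [x] lie in a span of [n] vectors, so some nonzero polynomial kills
    [x]; it splits over the complex numbers. *)
Lemma annihilating_roots x : finite_dimensional A ->
  exists s : seq R[i], \prod_(a <- s) (x - a *: (1 : A)) = 0.
Proof.
move=> [n [b bspan]].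
pose M := \matrix_(i < n.+1, j < n) projT1 (cid (bspan (x ^+ i))) j.
have ME (i : 'I_n.+1) : x ^+ i = \sum_j M i j *: b j.
  by under eq_bigr do rewrite mxE; case: cid.
have : kermx M != 0.
  rewrite -mxrank_eq0 mxrank_ker subn_eq0 -ltnNge ltnS; exact: rank_leq_col.
case/rowV0Pn => v /sub_kermxP vM v0.
pose p : {poly R[i]} := \poly_(i < n.+1) v 0 (inord i).
have p0 : p != 0.
  apply: contraNneq v0 => p0; apply/eqP/rowP => i; rewrite mxE.
  have := congr1 (fun q : {poly _} => q`_i) p0.
  by rewrite coef_poly ltn_ord inord_val coef0.
have px : \sum_(i < n.+1) p`_i *: x ^+ i = 0.
  transitivity (\sum_(i < n.+1) \sum_j (v 0 i * M i j) *: b j).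
    apply: eq_bigr => i _; rewrite coef_poly ltn_ord inord_val ME scaler_sumr.
    by apply: eq_bigr => j _; rewrite scalerA.
  rewrite exchange_big /= big1 // => j _; rewrite -scaler_suml.
  by move/rowP: vM => /(_ j); rewrite !mxE => ->; rewrite scale0r.
have [s [c [c0 ps]]] : exists (s : seq R[i]) (c : R[i]),
    c != 0 /\ p = c *: \prod_(a <- s) ('X - a%:P).
  have [s ps] := closed_field_poly_normal p; exists s, (lead_coef p).
  by rewrite lead_coef_eq0.
exists s; rewrite -(@prod_linear_factors _ _ n.+1); last first.
  by rewrite -(size_prod_XsubC s id) -(size_scale _ c0) -ps size_poly.
apply/eqP; rewrite -[_ == 0]orFb -(negPf c0) -scaler_eq0 scaler_sumr -[X in _ == X]px.
by apply/eqP/eq_bigr => i _; rewrite scalerA ps coefZ.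
Qed.

(* Dividing [x - a] out of the annihilating product one root at a time: if
   [(x - a) z = \sum_b w b] with [x w b = b w b], then
   [z - \sum_b w b / (b - a)] is an eigenvector for [a]. *)
Lemma eigenvector_decomposition x (s : seq R[i]) z : uniq s ->
    (\prod_(a <- s) (x - a *: (1 : A))) * z = 0 ->
  exists w : R[i] -> A, z = \sum_(a <- s) w a /\
    forall a, a \in s -> x * w a = a *: w a.
Proof.
elim: s z => [|a s IH] z.
  by rewrite big_nil mul1r => _ ->; exists (fun=> 0); rewrite big_nil.
rewrite big_cons /= => /andP[anotin us]; rewrite [_ * \prod_(_ <- _) _]cmulrC -mulrA.
case/(IH _ us) => w [wE ww].
have ab b : b \in s -> b - a != 0.
  by move=> bs; rewrite subr_eq0; apply: contraNneq anotin => <-.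
pose v b := if b == a then z - \sum_(c <- s) (c - a)^-1 *: w c
            else (b - a)^-1 *: w b.
have vE b : b \in s -> v b = (b - a)^-1 *: w b.
  by rewrite /v; case: eqP => // -> as_; rewrite as_ in anotin.
exists v; split.
  rewrite big_cons {1}/v eqxx (eq_big_seq _ vE).
  by rewrite subrK.
move=> b; rewrite inE => /orP[/eqP ->|bs]; last first.
  by rewrite vE // mulZr ww // !scalerA mulrC.
rewrite /v eqxx; apply/eqP; rewrite -subr_eq0.
have -> y : a *: y = (a *: (1 : A)) * y by rewrite mulZl mul1r.
rewrite -mulrBl mulrBr wE mulr_sumr -sumrB big_seq big1 // => c cs.
rewrite mulZr mulrBl ww // mulZl mul1r -scalerBl scalerA mulVf ?ab //.
by rewrite scale1r subrr.
Qed.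

(** The unit is decomposed into eigenvectors of [x], with distinct eigenvalues; these need not be
    nonzero. *)
Lemma spectral_partition x : finite_dimensional A ->
  exists (I : finType) (e : I -> A),
    [/\ forall i j, i != j -> e i * e j = 0, \sum_i e i = 1
      & forall i, exists a, x * e i = a *: e i].
Proof.
case/(annihilating_roots x) => s0 s0x; pose s := undup s0.
have us : uniq s := undup_uniq s0.
have sx : \prod_(a <- s) (x - a *: (1 : A)) = 0.
  have dvd a t : a \in t ->
      exists r, \prod_(b <- t) (x - b *: (1 : A)) = r * (x - a *: (1 : A)).
    elim: t => // b t IH; rewrite inE big_cons => /orP[/eqP <-|/IH[r ->]].
      by rewrite cmulrC; eexists.
    by rewrite mulrA; eexists.
  (* The product [y] over distinct roots divides out every root of [s0], so [y ^+ size s0] is a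
     multiple of the annihilating product. *)
  apply: (@nilpotent_eq0 _ (size s0)); set y := \prod_(_ <- _) _.
  suff dvdX t : {subset t <= s} ->
      exists r, y ^+ size t = r * \prod_(a <- t) (x - a *: (1 : A)).
    by case: (dvdX s0) => [a|r ->]; rewrite ?mem_undup // s0x mulr0.
  elim: t => [|a t IH] ts; first by exists 1; rewrite big_nil mulr1.
  have [|r yr] := IH; first by move=> b bt; rewrite ts // inE bt orbT.
  have [|r' yr'] := dvd a s; first by rewrite ts // inE eqxx.
  exists (r' * r); rewrite exprS yr {1}/y yr' big_cons -!mulrA; congr (_ * _).
  by rewrite mulrA [_ * r]cmulrC -mulrA.
have [|w [w1 ww]] := @eigenvector_decomposition x s 1 us.
  by rewrite sx mul0r.
pose e (i : 'I_(size s)) := w s`_i.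
have ee i : x * e i = s`_i *: e i by rewrite ww // mem_nth.
exists 'I_(size s), e; split => [i j ij||i]; last by exists s`_i.
  (* [x * (e i * e j)] equals both [s_i] times and [s_j] times [e i * e j]. *)
  have : (s`_i - s`_j) *: (e i * e j) = 0.
    rewrite scalerBl -mulZl -ee -mulZr -ee [x * e j]cmulrC.
    by rewrite [x * e i]cmulrC -!mulrA [x * e j]cmulrC subrr.
  move/eqP; rewrite scaler_eq0 subr_eq0 nth_uniq // => /orP[/eqP/val_inj|/eqP //].
  by move=> /eqP; rewrite (negPf ij).
by rewrite w1 (big_nth 0) big_mkord.
Qed.

(** By induction, the products [e i * f j] refine the partition already found by that of the next
    element. *)
Lemma joint_spectral_partition (xs : seq A) : finite_dimensional A ->
  exists (I : finType) (e : I -> A),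
    [/\ forall i j, i != j -> e i * e j = 0, \sum_i e i = 1
      & forall x i, x \in xs -> exists a, x * e i = a *: e i].
Proof.
move=> fdA; elim: xs => [|x xs [I [e [oe e1 xe]]]].
  exists unit, (fun=> 1); split=> //; last by rewrite big_const card_unit /= addr0.
have [J [f [of_ f1 xf]]] := spectral_partition x fdA.
exists (I * J)%type, (fun ij => e ij.1 * f ij.2); split.
- move=> [i j] [i' j'] /= ij.
  rewrite mulrA -[e i * f j * _]mulrA [f j * _]cmulrC mulrA -mulrA.
  have [ii|ii] := eqVneq i i'; last by rewrite oe // mul0r.
  rewrite (of_ j j') ?mulr0 //; apply: contraNneq ij => jj.
  by rewrite ii jj.
- rewrite -(pair_bigA _ (fun i j => e i * f j)) /=.
  by under eq_bigr do rewrite -mulr_sumr f1 mulr1.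
- move=> y [i j] /=; rewrite inE => /orP[/eqP ->|yxs].
    have [a xfj] := xf j; exists a.
    by rewrite mulrA [x * _]cmulrC -mulrA xfj mulZr.
  by have [a ye] := xe _ i yxs; exists a; rewrite mulrA ye mulZl.
Qed.

(** Diagonalizing a spanning family makes every [x] act on each [e i] by a scalar, so
    [x = \sum_i x * e i] is a combination of the [e i]. Zero blocks are then discarded. *)
Lemma commutative_atomic_basis : finite_dimensional A ->
  exists (n : nat) (e : 'I_n -> A), atomic_basis e.
Proof.
move=> fdA; have [m [b bspan]] := fdA.
have [I [e [oe e1 be]]] := joint_spectral_partition [seq b i | i : 'I_m] fdA.
have idem i : e i * e i = e i.
  rewrite -[RHS]mulr1 -e1 mulr_sumr (bigD1 i) //= big1 ?addr0 // => j ji.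
  by rewrite oe // eq_sym.
have scal x i : exists a, x * e i = a *: e i.
  have [k ->] := bspan x.
  have bi j : exists a, b j * e i = a *: e i by apply: be; rewrite map_f ?mem_enum.
  exists (\sum_j k j * projT1 (cid (bi j))); rewrite mulr_suml scaler_suml.
  by apply: eq_bigr => j _; rewrite mulZl; case: cid => a /= ->; rewrite scalerA.
pose P := [pred i | e i != 0].
have sumP (F : I -> A) : (forall i, e i = 0 -> F i = 0) ->
    \sum_(k < #|P|) F (enum_val k) = \sum_i F i.
  move=> F0; rewrite -(big_enum_val F) /= big_mkcond; apply: eq_bigr => i _.
  by rewrite inE; case: eqP => // /F0.
exists #|P|, (fun k => e (enum_val k)); split; first split.
- by move=> k; apply: idempotent_projection.
- by move=> k l kl; rewrite oe // (inj_eq enum_val_inj).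
- by rewrite (sumP e).
- by move=> k; apply/eqP; have := enum_valP k; rewrite inE.
- move=> x; pose a i := projT1 (cid (scal x i)).
  have xa i : x * e i = a i *: e i by rewrite /a; case: cid.
  exists (fun k => a (enum_val k)).
  rewrite (sumP (fun i => a i *: e i)) => [|i ->]; last by rewrite scaler0.
  by rewrite -{1}(mulr1 x) -e1 mulr_sumr; apply: eq_bigr.
Qed.

End CommutativeFiniteDimensional.

(** * C*-algebras generated by families of representations *)

Section Terms.
Variables (R : realType) (V : Type).

(** Formal *-polynomials, with no identification imposed: only their values matter. *)
Inductive star_term :=
| Tvar of V
| Tone
| Tadd of star_term & star_term
| Tmul of star_term & star_term
| Tscale of R[i] & star_term
| Tstar of star_term.

Fixpoint teval (B : cstarAlgType R) (q : V -> B) (t : star_term) : B :=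
  match t with
  | Tvar v => q v
  | Tone => 1
  | Tadd s t => teval q s + teval q t
  | Tmul s t => teval q s * teval q t
  | Tscale k t => k *: teval q t
  | Tstar t => star (teval q t)
  end.

Definition Tsub s t := Tadd s (Tscale (-1) t).

Lemma teval_sub (B : cstarAlgType R) (q : V -> B) s t :
  teval q (Tsub s t) = teval q s - teval q t.
Proof. by rewrite /= scaleN1r. Qed.

Lemma teval_morph (A B : cstarAlgType R) (f : starMorphism A B) (p : V -> A) t :
  f (teval p t) = teval (f \o p) t.
Proof.
elim: t => [v||s IHs t IHt|s IHs t IHt|k t IHt|t IHt] //=.
- exact: star_morph1r.
- by rewrite linearD /= IHs IHt.
- by rewrite star_morphMr IHs IHt.
- by rewrite linearZ /= IHt.
- by rewrite star_morph_star IHt.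
Qed.

End Terms.

(** The sequence consists of centres of balls of radius [2^-(n+2)] belonging to [F]; any two of
    these balls meet. One centre close to [l], with a small ball, already puts the ball around [l]
    in [F]. *)
Lemma cauchy_seq_complete (R : realType) (W : normedModType R[i]) :
    (forall u : nat -> W,
       (forall n m : nat, `|u (n + m)%N - u n| <= (2 ^- n : R)%:C) ->
     exists l, forall e : R, 0 < e ->
       exists n, 2 ^- n <= e /\ `|u n - l| <= e%:C) ->
  forall F : set_system W, ProperFilter F -> cauchy F -> cvg F.
Proof.
move=> seqW F FF Fc; have h0 n : 0 < (2 ^- n.+2 : R)%:C :> R[i].
  by rewrite ltcR invr_gt0 exprn_gt0.
have /choice[x Fx] n : exists x, F (ball x (2 ^- n.+2 : R)%:C).
  by move/cauchyP : Fc => /(_ _ (h0 n)).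
have dist n m : (n <= m)%N -> `|x m - x n| <= (2 ^- n.+1 : R)%:C.
  move=> nm; have [y [yn ym]] : exists y,
      ball (x n) (2 ^- n.+2 : R)%:C y /\ ball (x m) (2 ^- m.+2 : R)%:C y.
    exact: filter_ex (filterI (Fx n) (Fx m)).
  rewrite -ball_normE /ball_ /= in yn ym.
  rewrite -(subrK y (x m)) -addrA (le_trans (ler_normD _ _)) //.
  rewrite [`|y - _|]distrC (le_trans (lerD (ltW ym) (ltW yn))) //.
  rewrite -rmorphD /= lecR.
  have le : 2 ^- m.+2 <= 2 ^- n.+2 :> R.
    by rewrite lef_pV2 ?posrE ?exprn_gt0 // ler_weXn2l // ler1n.
  rewrite (le_trans (lerD le (lexx _))) // -[n.+2]addn1 exprD expr1 invfM -splitr //.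
have [|l xl] := seqW x.
  move=> n m; rewrite (le_trans (dist _ _ (leq_addr _ _))) // lecR.
  by rewrite lef_pV2 ?posrE ?exprn_gt0 // ler_weXn2l // ler1n.
apply/cvg_ex; exists l; apply/cvg_ballP => e e0.
have eE : e = (complex.Re e)%:C by rewrite RRe_real // ger0_real // ltW.
have e20 : 0 < complex.Re e / 2 by rewrite divr_gt0 // -ltcR -eE.
have [n [en xn]] := xl _ e20.
apply: filterS (Fx n) => y; rewrite -!ball_normE /ball_ /= => xy.
rewrite -(subrK (x n) l) -addrA (le_lt_trans (ler_normD _ _)) //.
rewrite {1}distrC eE [complex.Re e]splitr rmorphD /= ler_ltD //.
apply: lt_le_trans xy _; rewrite lecR (le_trans _ en) //.
by rewrite lef_pV2 ?posrE ?exprn_gt0 // ler_weXn2l // ?ler1n // ltnW.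
Qed.

(** * The complex numbers as a C*-algebra *)

Section ComplexAlgebra.
Variable R : realType.

Definition complex_alg : Type := R[i]^o.
HB.instance Definition _ := NormedModule.copy complex_alg R[i]^o.

Lemma real_cauchy_seq (u : nat -> R) :
    (forall n m : nat, `|u (n + m)%N - u n| <= 2 ^- n) ->
  exists l, forall n, `|u n - l| <= 2 ^- n.
Proof.
move=> uc.
have half1 : 2^-1 < 1 :> R by rewrite invf_lt1 // ltr1n.
have half0 : 0 <= 2^-1 :> R by rewrite invr_ge0.
have ucvg : cvg (u @ \oo)%classic.
  apply: cauchy_cvg; apply/cauchyP => e e0.
  have e20 : 0 < e / 2 by rewrite divr_gt0.
  have [N hN] := vanishing_geometric half0 half1 e20.
  exists (u N); exists N => // n /= nN.
  rewrite -ball_normE /ball_ /= distrC -(subnKC nN) (le_lt_trans (uc _ _)) //.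
  rewrite -exprVn (le_lt_trans (hN _ (leqnn N))) //.
  by rewrite ltr_pdivrMr // ltr_pMr ?ltr1n.
exists (lim (u @ \oo)%classic) => n; apply/ler_addgt0Pl => e e0.
move/cvgrPdist_le: ucvg => /(_ _ e0)[N _ h].
rewrite -(subrK (u (n + N)%N) (u n)) -addrA (le_trans (ler_normD _ _)) //.
rewrite [leRHS]addrC; apply: lerD; first by rewrite distrC.
by rewrite distrC; apply: h; rewrite /= leq_addl.
Qed.

Lemma complex_complete (F : set_system complex_alg) :
  ProperFilter F -> cauchy F -> cvg F.
Proof.
apply: cauchy_seq_complete => u uc.
have [a ua] : exists a, forall n, `|complex.Re (u n) - a| <= 2 ^- n.
  apply: real_cauchy_seq => n m; rewrite -lecR; apply: le_trans (uc n m).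
  rewrite normc_def lecR -sqrtr_sqr ler_wsqrtr //.
  by rewrite -raddfB lerDl sqr_ge0.
have [b ub] : exists b, forall n, `|complex.Im (u n) - b| <= 2 ^- n.
  apply: real_cauchy_seq => n m; rewrite -lecR; apply: le_trans (uc n m).
  rewrite normc_def lecR -sqrtr_sqr ler_wsqrtr //.
  by rewrite -raddfB lerDr sqr_ge0.
exists (a +i* b) => e e0; have e20 : 0 < e / 2 by rewrite divr_gt0.
have half1 : 2^-1 < 1 :> R by rewrite invf_lt1 // ltr1n.
have half0 : 0 <= 2^-1 :> R by rewrite invr_ge0.
have [N hN] := vanishing_geometric half0 half1 e20; exists N.
have eN : 2 ^- N <= e / 2 by rewrite -exprVn hN.
split; first by rewrite (le_trans eN) // ler_pdivrMr // ler_peMr ?ler1n // ltW.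
have -> : u N - (a +i* b) = (complex.Re (u N) - a)%:C + 'i%C * (complex.Im (u N) - b)%:C.
  by rewrite [LHS]complexE; case: (u N).
rewrite (le_trans (ler_normD _ _)) // normrM.
have -> : `|'i%C : R[i]| = 1 by rewrite normc_def /= expr0n expr1n add0r sqrtr1.
rewrite mul1r !normc_def /= expr0n addr0 addr0 !sqrtr_sqr -rmorphD lecR /=.
by rewrite [e]splitr lerD // (le_trans _ eN).
Qed.

HB.instance Definition _ := Uniform_isComplete.Build complex_alg complex_complete.

Let cx_one : complex_alg := 1 : R[i].
Let cx_mul (x y : complex_alg) : complex_alg := (x : R[i]) * y.
Let cx_star (x : complex_alg) : complex_alg := (x : R[i])^*.

Fact cx_normM (x y : complex_alg) : `|cx_mul x y| <= `|x| * `|y|.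
Proof. by rewrite -normrM. Qed.

Fact cx_starM (x y : complex_alg) :
  cx_star (cx_mul x y) = cx_mul (cx_star y) (cx_star x).
Proof. by rewrite /cx_star /cx_mul rmorphM mulrC. Qed.

Fact cx_cstar_identity (x : complex_alg) :
  `|cx_mul (cx_star x) x| = `|x| ^+ 2.
Proof.
suff : `|(x : R[i])^* * x| = `|(x : R[i])| ^+ 2 by [].
by rewrite normrM norm_conjC expr2.
Qed.

HB.instance Definition _ := isCStarAlgebra.Build R complex_alg
  (cone := cx_one) (cmul := cx_mul) (star := cx_star)
  (@mulrA R[i]) (@mul1r R[i]) (@mulr1 R[i]) (@mulrDl R[i]) (@mulrDr R[i])
  (fun k x y => esym (mulrA k x y)) (fun k x y => mulrCA x k y)
  cx_normM (@rmorphD _ _ Num.conj) (@rmorphM _ _ Num.conj) cx_starM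
  (@conjCK R[i]) cx_cstar_identity.

End ComplexAlgebra.

(** The bound, uniform over the index for each generator, puts the tuples of generators in the
    bounded product. *)
Record gen_family (R : realType) (V : Type) := GenFamily {
  fidx : Type;
  falg : fidx -> cstarAlgType R;
  fgen : forall i, V -> falg i;
  fgen_bounded : forall v, exists c, forall i, nrm (fgen i v) <= c
}.
Arguments falg {R V} g.
Arguments fgen {R V} g.

(* [gen_alg F] below is the closed *-subalgebra generated by the tuples
   [(fgen F i v)_i] in the bounded product of the algebras [falg F i]. *)
Section Approximable.
Variables (R : realType) (V : Type) (F : gen_family R V).

(** One term serves all indices at once: this is closeness in the supremum norm. *)
Definition approximable (x : forall i, falg F i) :=
  forall e : R, 0 < e -> exists t, forall i, nrm (x i - teval (fgen F i) t) <= e.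

Lemma teval_bounded t : exists c, forall i, nrm (teval (fgen F i) t) <= c.
Proof.
elim: t => [v||s [c hc] t [d hd]|s [c hc] t [d hd]|k t [d hd]|t [d hd]] /=.
- exact: fgen_bounded.
- by exists 1 => i; exact: nrm1_le.
- by exists (c + d) => i; rewrite (le_trans (nrmD _ _)) // lerD.
- exists (c * d) => i; rewrite (le_trans (nrmM _ _)) //.
  by rewrite ler_pM ?nrm_ge0.
- exists (complex.Re `|k| * d) => i; rewrite nrmZ ler_wpM2l //.
  by rewrite -lecR RRe_real ?normr_ge0 ?ger0_real.
- by exists d => i; rewrite nrm_star.
Qed.

Lemma approx_bounded x : approximable x -> exists c, forall i, nrm (x i) <= c.
Proof.
case/(_ 1) => // t xt; have [c tc] := teval_bounded t.
exists (1 + c) => i; rewrite -(subrK (teval (fgen F i) t) (x i)).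
by rewrite (le_trans (nrmD _ _)) // lerD.
Qed.

Lemma approx_teval t : approximable (fun i => teval (fgen F i) t).
Proof. by move=> e e0; exists t => i; rewrite subrr nrm0 ltW. Qed.

Lemma approx_limit x :
  (forall e, 0 < e -> exists y, approximable y /\ forall i, nrm (x i - y i) <= e) ->
  approximable x.
Proof.
move=> xy e e0; have e20 : 0 < e / 2 by rewrite divr_gt0.
have [y [ya hy]] := xy _ e20; have [t ht] := ya _ e20.
exists t => i; rewrite (le_trans (nrm_tri (y i) _ _)) // [leRHS]splitr.
by rewrite lerD.
Qed.

Lemma approxD x y : approximable x -> approximable y -> approximable (fun i => x i + y i).
Proof.
move=> xa ya e e0; have e20 : 0 < e / 2 by rewrite divr_gt0.
have [s hs] := xa _ e20; have [t ht] := ya _ e20.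
exists (Tadd s t) => i /=; rewrite opprD addrACA (le_trans (nrmD _ _)) //.
by rewrite [leRHS]splitr lerD.
Qed.

Lemma approxZ k x : approximable x -> approximable (fun i => k *: x i).
Proof.
move=> xa e e0; set c := complex.Re `|k|.
have c0 : 0 <= c by rewrite -lecR RRe_real ?normr_ge0 ?ger0_real.
have c1 : 0 < c + 1 by rewrite ltr_wpDl.
have [t ht] := xa _ (divr_gt0 e0 c1).
exists (Tscale k t) => i /=; rewrite -scalerBr nrmZ -/c.
have := ht i; rewrite ler_pdivlMr // => h; apply: le_trans h.
by rewrite mulrC ler_wpM2l ?nrm_ge0 // lerDl.
Qed.

(** The order of choices matters: [t] depends on a bound for [x], then [s] on a bound for the values
    of [t]. *)
Lemma approxM x y : approximable x -> approximable y -> approximable (fun i => x i * y i).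
Proof.
move=> xa ya.
have [c hc] := approx_bounded xa.
apply: approx_limit => e e0.
have c1 : 0 < `|c| + 1 by rewrite ltr_wpDl.
have e20 : 0 < e / 2 by rewrite divr_gt0.
have [t ht] := ya _ (divr_gt0 e20 c1).
have [d hd] := teval_bounded t.
have d1 : 0 < `|d| + 1 by rewrite ltr_wpDl.
have [s hs] := xa _ (divr_gt0 e20 d1).
exists (fun i => teval (fgen F i) (Tmul s t)); split=> [|i /=].
  exact: approx_teval.
set u := teval _ s; set v := teval _ t.
have -> : x i * y i - u * v = x i * (y i - v) + (x i - u) * v.
  by rewrite mulrBr mulrBl addrA subrK.
rewrite (le_trans (nrmD _ _)) // [leRHS]splitr lerD //.
  rewrite (le_trans (nrmM _ _)) //; have := ht i; rewrite ler_pdivlMr // => h.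
  apply: le_trans h; rewrite mulrC ler_wpM2l ?nrm_ge0 //.
  by rewrite (le_trans (hc i)) // (le_trans (ler_norm _)) // lerDl.
rewrite (le_trans (nrmM _ _)) //; have := hs i; rewrite ler_pdivlMr // => h.
apply: le_trans h; rewrite ler_wpM2l ?nrm_ge0 //.
by rewrite (le_trans (hd i)) // (le_trans (ler_norm _)) // lerDl.
Qed.

Lemma approx_star x : approximable x -> approximable (fun i => star (x i)).
Proof.
move=> xa e /xa[t ht]; exists (Tstar t) => i /=.
by rewrite -starB nrm_star.
Qed.

Lemma approx1 : approximable (fun=> 1).
Proof. exact: (approx_teval (@Tone R V)). Qed.

Lemma approx0 : approximable (fun=> 0).
Proof.
by move=> e e0; exists (Tsub (@Tone R V) (Tone _ _)) => i;
  rewrite teval_sub !subrr nrm0 ltW.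
Qed.

Lemma approxN x : approximable x -> approximable (fun i => - x i).
Proof.
move=> xa e e0; have [t ht] := approxZ (-1) xa e0.
by exists t => i; rewrite -scaleN1r.
Qed.

Record gen_alg := GenAlg { gval :> forall i, falg F i; gvalP : approximable gval }.

Lemma gen_alg_eq (x y : gen_alg) : (forall i, x i = y i) -> x = y.
Proof.
case: x y => [x xa] [y ya] /= xy.
have {}xy : x = y by exact: functional_extensionality_dep.
by move: ya; rewrite -xy => ya; rewrite (Prop_irrelevance xa ya).
Qed.

HB.instance Definition _ := gen_eqMixin gen_alg.
HB.instance Definition _ := gen_choiceMixin gen_alg.

Definition gadd (x y : gen_alg) := GenAlg (approxD (gvalP x) (gvalP y)).
Definition gopp (x : gen_alg) := GenAlg (approxN (gvalP x)).
Definition gzero := GenAlg approx0.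
Definition gscale k (x : gen_alg) := GenAlg (approxZ k (gvalP x)).
Definition gone := GenAlg approx1.
Definition gmul (x y : gen_alg) := GenAlg (approxM (gvalP x) (gvalP y)).
Definition gstar (x : gen_alg) := GenAlg (approx_star (gvalP x)).

Fact gaddA : associative gadd.
Proof. by move=> x y z; apply: gen_alg_eq => i /=; rewrite addrA. Qed.
Fact gaddC : commutative gadd.
Proof. by move=> x y; apply: gen_alg_eq => i /=; rewrite addrC. Qed.
Fact gadd0 : left_id gzero gadd.
Proof. by move=> x; apply: gen_alg_eq => i /=; rewrite add0r. Qed.
Fact gaddN : left_inverse gzero gopp gadd.
Proof. by move=> x; apply: gen_alg_eq => i /=; rewrite addNr. Qed.
HB.instance Definition _ := GRing.isZmodule.Build gen_alg gaddA gaddC gadd0 gaddN.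

Fact gscaleA a b x : gscale a (gscale b x) = gscale (a * b) x.
Proof. by apply: gen_alg_eq => i /=; rewrite scalerA. Qed.
Fact gscale1 : left_id 1 gscale.
Proof. by move=> x; apply: gen_alg_eq => i /=; rewrite scale1r. Qed.
Fact gscaleDr : right_distributive gscale +%R.
Proof. by move=> k x y; apply: gen_alg_eq => i /=; rewrite scalerDr. Qed.
Fact gscaleDl x : {morph gscale^~ x : a b / a + b}.
Proof. by move=> a b; apply: gen_alg_eq => i /=; rewrite scalerDl. Qed.
HB.instance Definition _ := GRing.Zmodule_isLmodule.Build R[i] gen_alg
  gscaleA gscale1 gscaleDr gscaleDl.

(** Over an empty index set the supremum is 0, as befits the zero algebra. *)
Definition gen_norm (x : gen_alg) : R :=
  sup [set nrm (x i) | i in [set: fidx F]]%classic.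

Lemma gen_norm_ub (x : gen_alg) i : nrm (x i) <= gen_norm x.
Proof.
have [c hc] := approx_bounded (gvalP x).
apply: ub_le_sup; last by exists i.
by exists c => _ [j _ <-].
Qed.

Lemma gen_norm_le (x : gen_alg) c : 0 <= c -> (forall i, nrm (x i) <= c) ->
  gen_norm x <= c.
Proof.
move=> c0 hc; rewrite /gen_norm; set S := image _ _.
have [->|/set0P S0] := eqVneq S set0%classic; first by rewrite sup0.
by apply: ge_sup => // _ [j _ <-].
Qed.

Lemma gen_norm_ge0 x : 0 <= gen_norm x.
Proof.
have [[j]|noi] := pselect (inhabited (fidx F)).
  by apply: le_trans (gen_norm_ub x j); exact: nrm_ge0.
rewrite /gen_norm (_ : image _ _ = set0)%classic ?sup0 //.
by rewrite -subset0 => y [j]; case: noi; exists.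
Qed.

Fact gen_normD (x y : gen_alg) : (gen_norm (x + y))%:C <= (gen_norm x)%:C + (gen_norm y)%:C.
Proof.
rewrite -rmorphD lecR /=; apply: gen_norm_le => [|i]; first by rewrite addr_ge0 ?gen_norm_ge0.
by rewrite (le_trans (nrmD _ _)) // lerD ?gen_norm_ub.
Qed.
Fact gen_normZ_le k (x : gen_alg) : gen_norm (k *: x) <= complex.Re `|k| * gen_norm x.
Proof.
have c0 : 0 <= complex.Re `|k| by rewrite -lecR RRe_real ?normr_ge0 ?ger0_real.
apply: gen_norm_le => [|i]; first by rewrite mulr_ge0 ?gen_norm_ge0.
by rewrite nrmZ ler_wpM2l ?gen_norm_ub.
Qed.
(** For [k] nonzero, the reverse inequality is [gen_normZ_le] at [k^-1] and [k *: x]. *)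
Fact gen_normZ k (x : gen_alg) : (gen_norm (k *: x))%:C = `|k| * (gen_norm x)%:C.
Proof.
have kE : `|k| = (complex.Re `|k|)%:C by rewrite RRe_real ?ger0_real.
have := gen_normZ_le k x; have := gen_normZ_le k^-1 (k *: x).
rewrite kE -rmorphM; set c := complex.Re `|k| in kE * => le1 le2.
congr _%:C; apply/eqP; rewrite eq_le le2 /=.
have [k0|k0] := eqVneq k 0.
  move: kE; rewrite k0 normr0 => /esym/complexI ->.
  by rewrite mul0r gen_norm_ge0.
have c0 : 0 < c by rewrite -ltcR -kE normr_gt0.
move: le1; rewrite scalerA mulVf // scale1r normfV kE -fmorphV /=.
by rewrite mulrC ler_pdivlMr // mulrC.
Qed.
Fact gen_norm_eq0 (x : gen_alg) : (gen_norm x)%:C = 0 -> x = 0.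
Proof.
move=> /complexI x0; apply: gen_alg_eq => i; apply: nrm0_eq0; apply/eqP.
by rewrite eq_le nrm_ge0 -x0 gen_norm_ub.
Qed.
HB.instance Definition _ := Lmodule_isNormed.Build R[i] gen_alg
  gen_normD gen_normZ gen_norm_eq0.

Lemma gen_normE (x : gen_alg) : `|x| = (gen_norm x)%:C. Proof. by []. Qed.

(** Limits are taken coordinatewise; the convergence is uniform in the index, so the limit stays
    approximable. *)
Fact gen_alg_complete (G : set_system gen_alg) :
  ProperFilter G -> cauchy G -> cvg G.
Proof.
apply: cauchy_seq_complete => u uc.
have half1 : 2^-1 < 1 :> R by rewrite invf_lt1 // ltr1n.
have half0 : 0 <= 2^-1 :> R by rewrite invr_ge0.
have van := vanishing_geometric half0 half1.
have uci i n m : nrm (u (n + m)%N i - u n i) <= 2^-1 ^+ n.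
  apply: (le_trans (gen_norm_ub (u (n + m)%N - u n) i)).
  by rewrite exprVn -lecR; apply: uc.
have ul_ i : exists l, tends (fun n => u n i) l := cauchy_tends van (@uci i).
pose l i := projT1 (cid (ul_ i)).
have ul i : tends (fun n => u n i) (l i) by rewrite /l; case: cid.
have le_ul i n : nrm (u n i - l i) <= 2 ^- n.
  apply/ler_addgt0Pl => e e0; have [N hN] := ul i _ e0.
  rewrite (le_trans (nrm_tri (u (n + N)%N i) _ _)) // [leRHS]addrC lerD //.
    by rewrite nrmC -exprVn.
  by rewrite hN // leq_addl.
have la : approximable l.
  apply: approx_limit => e /van[N hN]; exists (u N); split=> [|i].
    exact: gvalP.
  by rewrite nrmC (le_trans (le_ul i N)) // -exprVn hN.
exists (GenAlg la) => e e0; have [N hN] := van _ e0; exists N.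
have eN : 2 ^- N <= e by rewrite -exprVn hN.
split=> //; rewrite gen_normE lecR; apply: gen_norm_le => [|i]; first exact: ltW.
exact: le_trans (le_ul i N) eN.
Qed.
HB.instance Definition _ := Uniform_isComplete.Build gen_alg gen_alg_complete.

Fact gmulA : associative gmul.
Proof. by move=> x y z; apply: gen_alg_eq => i /=; rewrite mulrA. Qed.
Fact gmul1x : left_id gone gmul.
Proof. by move=> x; apply: gen_alg_eq => i /=; rewrite mul1r. Qed.
Fact gmulx1 : right_id gone gmul.
Proof. by move=> x; apply: gen_alg_eq => i /=; rewrite mulr1. Qed.
Fact gmulDl : left_distributive gmul +%R.
Proof. by move=> x y z; apply: gen_alg_eq => i /=; rewrite mulrDl. Qed.
Fact gmulDr : right_distributive gmul +%R.
Proof. by move=> x y z; apply: gen_alg_eq => i /=; rewrite mulrDr. Qed.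
Fact gmulZl k (x y : gen_alg) : gmul (k *: x) y = k *: gmul x y.
Proof. by apply: gen_alg_eq => i /=; rewrite mulZl. Qed.
Fact gmulZr k (x y : gen_alg) : gmul x (k *: y) = k *: gmul x y.
Proof. by apply: gen_alg_eq => i /=; rewrite mulZr. Qed.
Fact gnormM (x y : gen_alg) : `|gmul x y| <= `|x| * `|y|.
Proof.
rewrite !gen_normE -rmorphM lecR /=; apply: gen_norm_le => [|i].
  by rewrite mulr_ge0 ?gen_norm_ge0.
by rewrite (le_trans (nrmM _ _)) // ler_pM ?nrm_ge0 ?gen_norm_ub.
Qed.
Fact gstarD (x y : gen_alg) : gstar (x + y) = gstar x + gstar y.
Proof. by apply: gen_alg_eq => i /=; rewrite starD. Qed.
Fact gstarZ k (x : gen_alg) : gstar (k *: x) = k^* *: gstar x.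
Proof. by apply: gen_alg_eq => i /=; rewrite starZ. Qed.
Fact gstarM (x y : gen_alg) : gstar (gmul x y) = gmul (gstar y) (gstar x).
Proof. by apply: gen_alg_eq => i /=; rewrite starMr. Qed.
Fact gstarK : involutive gstar.
Proof. by move=> x; apply: gen_alg_eq => i /=; rewrite starK. Qed.
Fact gstar_identity (x : gen_alg) : `|gmul (gstar x) x| = `|x| ^+ 2.
Proof.
rewrite !gen_normE -rmorphXn /=; congr _%:C; apply/eqP; rewrite eq_le.
apply/andP; split.
  apply: gen_norm_le => [|i]; first by rewrite exprn_ge0 ?gen_norm_ge0.
  by rewrite nrm_cstar lerXn2r ?nnegrE ?nrm_ge0 ?gen_norm_ge0 ?gen_norm_ub.
set N := gen_norm (gmul _ _); have N0 : 0 <= N := gen_norm_ge0 _.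
rewrite -[leRHS](sqr_sqrtr N0) lerXn2r ?nnegrE ?gen_norm_ge0 ?sqrtr_ge0 //.
apply: gen_norm_le => [|i]; first exact: sqrtr_ge0.
rewrite -[leLHS]ger0_norm ?nrm_ge0 // -sqrtr_sqr ler_wsqrtr // -nrm_cstar.
exact: (gen_norm_ub (gmul (gstar x) x) i).
Qed.
HB.instance Definition _ := isCStarAlgebra.Build R gen_alg gmulA gmul1x gmulx1
  gmulDl gmulDr gmulZl gmulZr gnormM gstarD gstarZ gstarM gstarK gstar_identity.

Definition ggen (v : V) : gen_alg := GenAlg (approx_teval (Tvar R v)).

Lemma teval_ggen t i : teval ggen t i = teval (fgen F i) t.
Proof.
elim: t => [v||s IHs t IHt|s IHs t IHt|k t IHt|t IHt] //=.
- by rewrite -IHs -IHt.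
- by rewrite -IHs -IHt.
- by rewrite -IHt.
- by rewrite -IHt.
Qed.

Lemma ggen_dense (x : gen_alg) e : 0 < e -> exists t, nrm (x - teval ggen t) <= e.
Proof.
move=> e0; have [t ht] := gvalP x e0; exists t.
rewrite /nrm gen_normE /=; apply: gen_norm_le => [|i]; first exact: ltW.
by have := ht i; rewrite -teval_ggen.
Qed.

(** Both morphisms agree on values of terms, which are dense, and are continuous with constant 2;
    hence the tolerance [e / 4]. *)
Lemma ggen_morphism_eq (B : cstarAlgType R) (f g : starMorphism gen_alg B) :
  (forall v, f (ggen v) = g (ggen v)) -> f = g.
Proof.
move=> fg; apply: starMorphism_eq => x; apply/eqP; rewrite -subr_eq0; apply/eqP.
apply: nrm_eq0P => e e0; have e40 : 0 < e / 4 by rewrite divr_gt0.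
have [t xt] := ggen_dense x e40.
have fgt : f (teval ggen t) = g (teval ggen t).
  by rewrite !teval_morph; congr teval; apply/funext => v /=.
have := nrm_tri (f (teval ggen t)) (f x) (g x).
have <- : f (x - teval ggen t) = f x - f (teval ggen t) by rewrite linearB.
have <- : g (teval ggen t - x) = f (teval ggen t) - g x by rewrite linearB fgt.
have := star_morph_bounded f (x - teval ggen t).
have := star_morph_bounded g (teval ggen t - x).
rewrite [nrm (_ - x)]nrmC; lra.
Qed.

End Approximable.

(** * Universal property of a generated algebra *)

Section Lift.
Variables (R : realType) (V : Type) (F : gen_family R V).
Variables (B : cstarAlgType R) (q : V -> B).
(** Makes evaluation at [q] contractive on terms for the norm of [gen_alg F]. *)
Hypothesis q_le : forall t, exists i, nrm (teval q t) <= nrm (teval (fgen F i) t).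

(** [B] is adjoined to the family as one more index; the lift is then read off as a graph inside the
    larger generated algebra. *)
Let ext_alg (o : option (fidx F)) : cstarAlgType R :=
  if o is Some i then falg F i else B.

Let ext_gen (o : option (fidx F)) : V -> ext_alg o :=
  match o with Some i => fgen F i | None => q end.

Let ext_bounded v : exists c, forall o, nrm (ext_gen o v) <= c.
Proof.
have [c hc] := fgen_bounded F v; exists c => -[j|] /=; first exact: hc.
by have [i hi] := q_le (Tvar R v); exact: le_trans (hc i).
Qed.

Let ext_family := GenFamily ext_bounded.

Let ext_pair (x : forall i, falg F i) (y : B) (o : option (fidx F)) : ext_alg o :=
  match o with Some i => x i | None => y end.

(* Approximating [x] and [y] by values of the same terms makes this relation
   compatible with all the operations at once. *)
Let graph (x : gen_alg F) (y : B) : Prop := @approximable _ _ ext_family (ext_pair x y).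

Let graph_ext (x : gen_alg F) y (z : forall o, ext_alg o) :
  @approximable _ _ ext_family z -> (forall o, z o = ext_pair x y o) -> graph x y.
Proof. by move=> za zE e /za[t ht]; exists t => o; rewrite -zE. Qed.

(** Terms approximating [(x, y)] and [(x, y')] are close over [F], hence by [q_le] close in [B]. *)
Let graph_fun x y y' : graph x y -> graph x y' -> y = y'.
Proof.
move=> xy xy'; apply/eqP; rewrite -subr_eq0; apply/eqP/nrm_eq0P => e e0.
have e40 : 0 < e / 4 by rewrite divr_gt0.
have [t ht] := xy _ e40; have [t' ht'] := xy' _ e40.
have [j] := q_le (Tsub t t'); rewrite !teval_sub.
have /= := ht None; have /= := ht (Some j).
have /= := ht' None; have /= := ht' (Some j).
set u := teval _ t; set u' := teval _ t'; set v := teval _ t; set v' := teval _ t'.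
have := nrm_tri v y y'; have := nrm_tri v' v y'; have := nrm_tri (x j) u u'.
rewrite (nrmC u (x j)) (nrmC v' y'); lra.
Qed.

Let graph_total x : exists y, graph x y.
Proof.
have half1 : 2^-1 < 1 :> R by rewrite invf_lt1 // ltr1n.
have half0 : 0 <= 2^-1 :> R by rewrite invr_ge0.
have van := vanishing_geometric half0 half1.
(* The exponent [n.+1] lets two such errors add up to at most [2^-n]. *)
have t_ n : exists t, forall i, nrm (x i - teval (fgen F i) t) <= 2^-1 ^+ n.+1.
  by apply: gvalP; rewrite exprn_gt0 ?invr_gt0.
pose t n := projT1 (cid (t_ n)).
have tx n i : nrm (x i - teval (fgen F i) (t n)) <= 2^-1 ^+ n.+1.
  by rewrite /t; case: cid.
have t_cauchy n m : nrm (teval q (t (n + m)%N) - teval q (t n)) <= 2^-1 ^+ n.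
  rewrite -teval_sub; have [i hi] := q_le (Tsub (t (n + m)%N) (t n)).
  rewrite (le_trans hi) // teval_sub (le_trans (nrm_tri (x i) _ _)) //.
  have := tx n i; have := tx (n + m)%N i; rewrite [nrm (x i - _)]nrmC.
  have : 2^-1 ^+ (n + m).+1 <= 2^-1 ^+ n.+1 :> R.
    by rewrite ler_wiXn2l ?ltnS ?leq_addr // ltW.
  rewrite [2^-1 ^+ n.+1]exprS; lra.
have [y ty] := cauchy_tends van t_cauchy; exists y => e e0.
have [N hN] := ty _ e0; have [M hM] := van _ e0.
exists (t (maxn N M)) => -[j|] /=; last by rewrite nrmC hN // leq_maxl.
by rewrite (le_trans (tx _ _)) // hM // (leq_trans (leq_maxr N M)).
Qed.

Lemma gen_alg_lift : exists f : starMorphism (gen_alg F) B,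
  forall v, f (ggen F v) = q v.
Proof.
pose f x := projT1 (cid (graph_total x)).
have fP x : graph x (f x) by rewrite /f; case: cid.
have fE x y : graph x y -> f x = y by apply: graph_fun.
have [|||x|g gE] := @make_starMorphism _ _ _ f.
- move=> k x y; apply: fE.
  by apply: graph_ext (approxD (approxZ k (fP x)) (fP y)) _; case.
- by apply: fE; apply: graph_ext (approx1 ext_family) _; case.
- move=> x y; apply: fE.
  by apply: graph_ext (approxM (fP x) (fP y)) _; case.
- by apply: fE; apply: graph_ext (approx_star (fP x)) _; case.
exists g => v; rewrite gE; apply: fE.
by apply: graph_ext (approx_teval ext_family (Tvar R v)) _; case.
Qed.

End Lift.

(** * Existence of the free hypergraph algebra *)

Section FreeAlgebra.
Variables (R : realType) (H : hypergraph).

Let seminorm := {N : star_term R (vertex H) -> R | exists (B : cstarAlgType R)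
  (q : vertex H -> B), hypergraph_relations q /\ forall t, N t = nrm (teval q t)}.

Let rep_alg (N : seminorm) : cstarAlgType R := projT1 (cid (projT2 N)).
Let rep_gen (N : seminorm) : vertex H -> rep_alg N :=
  projT1 (cid (projT2 (cid (projT2 N)))).
Let rep_rel (N : seminorm) : hypergraph_relations (@rep_gen N).
Proof. exact: (proj1 (projT2 (cid (projT2 (cid (projT2 N)))))). Qed.
Let rep_norm (N : seminorm) t : projT1 N t = nrm (teval (@rep_gen N) t).
Proof. exact: (proj2 (projT2 (cid (projT2 (cid (projT2 N)))))). Qed.

Let rep_bounded v : exists c, forall N, nrm (@rep_gen N v) <= c.
Proof. by exists 1 => N; apply: nrm_proj; case: (@rep_rel N). Qed.

(* The representations of the relations are indexed by the seminorms they induce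
   on terms: unlike the representations themselves, these form a small type. *)
Let free_family := GenFamily rep_bounded.

(** The relations hold index by index. A representation [q] lifts because the seminorm it induces is
    itself an index, at which every term has the same norm as under [q]. *)
Lemma free_hypergraph_exists : exists A : cstarAlgType R, is_free_hypergraph_cstar H A.
Proof.
exists (gen_alg free_family), (ggen free_family); split.
  split=> [v|e eH].
    split; apply: gen_alg_eq => N /=; have [/(_ v)[sv vv] _] := @rep_rel N.
      exact: sv.
    exact: vv.
  apply: gen_alg_eq => N; have [_ /(_ _ eH) sumE] := @rep_rel N.
  have gvalD x y : gval (x + y : gen_alg free_family) N = gval x N + gval y N by [].
  have gval0 : gval (0 : gen_alg free_family) N = 0 by [].
  rewrite (big_morph (fun x : gen_alg free_family => gval x N) gvalD gval0);
    exact: sumE.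
move=> B q qrel.
pose N0 : seminorm := exist _ (fun t => nrm (teval q t))
  (ex_intro _ B (ex_intro _ q (conj qrel (fun t => erefl)))).
have [|f fq] := @gen_alg_lift _ _ free_family B q.
  by move=> t; exists N0; rewrite -[leRHS]rep_norm.
exists f; split=> // g gq; apply: ggen_morphism_eq => v.
by rewrite gq; apply: fq.
Qed.
End FreeAlgebra.

(** * Finite colimits are free hypergraph algebras *)

Section AtomicProjections.
Variables (R : realType) (A : cstarAlgType R) (X : finType) (e : X -> A).
Hypothesis be : atomic_basis e.

Lemma sum_scaled_set (S : {set X}) :
  \sum_(i in S) e i = \sum_i ((i \in S)%:R : R[i]) *: e i.
Proof.
rewrite big_mkcond; apply: eq_bigr => i _.
by case: (i \in S); rewrite ?scale1r ?scale0r.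
Qed.

Lemma atomic_basis_set_inj (S T : {set X}) :
  \sum_(i in S) e i = \sum_(i in T) e i -> S = T.
Proof.
rewrite !sum_scaled_set => /(atomic_basis_inj be) ST; apply/setP => i.
have := ST i; case: (i \in S); case: (i \in T) => //= /eqP.
  by rewrite oner_eq0.
by rewrite eq_sym oner_eq0.
Qed.

(** The coordinates of [p] are idempotent scalars, hence 0 or 1. *)
Lemma atomic_basis_projection (p : A) : projection p ->
  exists S : {set X}, p = \sum_(i in S) e i.
Proof.
case=> _ pp; have [pe _ espan] := be; have [k pk] := espan p.
rewrite cmulE pk partition_mul // in pp.
exists [set i | k i != 0]; rewrite sum_scaled_set pk; apply: eq_bigr => i _.
congr (_ *: _); have /eqP := atomic_basis_inj be pp i; rewrite inE.
have [-> //|k0] := eqVneq (k i) 0; rewrite -subr_eq0 -{3}(mulr1 (k i)) -mulrBr.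
by rewrite mulf_eq0 (negPf k0) /= subr_eq0 => /eqP.
Qed.

End AtomicProjections.

(** * The hypergraph of a diagram *)

Section DiagramHypergraph.
Variables (R : realType) (J : category) (D : functor J (cstar_alg1 R)).
Variables (n : nat) (ob : 'I_n -> obj J).
Hypothesis o_surj : forall j, exists i, ob i = j.
Variables (nb : obj J -> nat) (eb : forall j, 'I_(nb j) -> (D j : cstarAlgType R)).
Hypothesis eb_basis : forall j, atomic_basis (@eb j).

Let Dmap i j (u : Defs.hom i j) : starMorphism (D i) (D j) := Defs.fmap D u.

Lemma fmap_atoms i j (u : Defs.hom i j) k :
  exists S : {set 'I_(nb j)}, Dmap u (eb k) = \sum_(l in S) eb l.
Proof.
apply: atomic_basis_projection => //; have [pe _ _] := eb_basis i.
by have [/(_ k)] := morphism_partition (Dmap u) pe.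
Qed.

(** Dually, [u] is a map from the atoms of [D j] to those of [D i], and this is its fibre over
    [k]. *)
Definition atoms i j (u : Defs.hom i j) k : {set 'I_(nb j)} := projT1 (cid (fmap_atoms u k)).

Lemma atomsE i j (u : Defs.hom i j) k : Dmap u (eb k) = \sum_(l in atoms u k) eb l.
Proof. by rewrite /atoms; case: cid. Qed.

Lemma atoms_id j (k : 'I_(nb j)) : atoms (catid j) k = [set k].
Proof.
apply: (atomic_basis_set_inj (eb_basis j)).
by rewrite -atomsE big_set1 /Dmap fmap_id.
Qed.

(* Two copies of the atoms of every [D (ob a)]: the copy tagged [true] lets an
   edge express [p_k = \sum_(l in S) p_l] even when both sides come from the
   same object. *)
Definition dvertex : finType := ({a : 'I_n & 'I_(nb (ob a))} * bool)%type.

Definition atom_vertex (c : bool) a (k : 'I_(nb (ob a))) : dvertex :=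
  (existT (fun a => 'I_(nb (ob a))) a k, c).

Lemma atom_vertex_inj c a : injective (@atom_vertex c a).
Proof. by move=> k l [] /eqP; rewrite -tag_eqE /tag_eq eqxx /= tagged_asE => /eqP. Qed.

Definition object_edge a : {set dvertex} := [set @atom_vertex false a k | k : 'I_(nb (ob a))].
(** Set against the sum over [object_edge a], a sum 1 here says that [p_k] is the sum of the tagged
    atoms in [atoms u k]. *)
Definition arrow_edge a b (u : Defs.hom (ob a) (ob b)) k : {set dvertex} :=
  [set @atom_vertex false a l | l in [set~ k]] :|:
  [set @atom_vertex true b l | l in atoms u k].

Definition dedges : {set {set dvertex}} := [set s | `[< (exists a, s = object_edge a) \/
  exists a b (u : Defs.hom (ob a) (ob b)) k, s = arrow_edge u k >] ].

Lemma object_edge_in a : object_edge a \in dedges.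
Proof. by rewrite inE; apply/asboolP; left; exists a. Qed.
Lemma arrow_edge_in a b (u : Defs.hom (ob a) (ob b)) k : arrow_edge u k \in dedges.
Proof. by rewrite inE; apply/asboolP; right; exists a, b, u, k. Qed.

Lemma dvertex_covered v : exists2 s, s \in dedges & v \in s.
Proof.
case: v => -[a k] []; last first.
  by exists (object_edge a); [exact: object_edge_in|exact: imset_f].
(* Tagged copies are covered by identity arrows. *)
exists (arrow_edge (catid (ob a)) k); first exact: arrow_edge_in.
by rewrite inE orbC (imset_f (@atom_vertex true a)) // atoms_id set11.
Qed.

Definition diagram_hypergraph : hypergraph := Hypergraph dvertex_covered.

Section Families.
Variables (B : cstarAlgType R) (q : dvertex -> B).

Lemma sum_object_edge a :
  \sum_(v in object_edge a) q v = \sum_k q (@atom_vertex false a k).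
Proof. by rewrite big_imset //= => k l _ _ /atom_vertex_inj. Qed.

Lemma sum_arrow_edge a b (u : Defs.hom (ob a) (ob b)) k :
  \sum_(v in arrow_edge u k) q v =
  \sum_(l | l != k) q (@atom_vertex false a l) +
  \sum_(l in atoms u k) q (@atom_vertex true b l).
Proof.
rewrite /arrow_edge; set S := imset _ _; set T := imset _ _.
transitivity (\sum_(v in [predU S & T]) q v).
  by apply: eq_bigl => v; rewrite !inE.
rewrite bigU /=; last first.
  rewrite -setI_eq0; apply/eqP/setP => v; rewrite !inE; apply/andP => -[].
  by case/imsetP => l _ -> /imsetP[l' _ []].
rewrite !big_imset => [|l l' _ _ /atom_vertex_inj|l l' _ _ /atom_vertex_inj] //=.
by congr (_ + _); apply: eq_bigl => l; rewrite !inE.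
Qed.

Lemma diagram_relationsP : @hypergraph_relations R diagram_hypergraph B q <->
  [/\ forall a, partition_of_unity (fun k => q (@atom_vertex false a k)),
      forall a b (u : Defs.hom (ob a) (ob b)) k,
        q (atom_vertex false k) = \sum_(l in atoms u k) q (atom_vertex false l)
    & forall a (k : 'I_(nb (ob a))), q (atom_vertex true k) = q (atom_vertex false k)].
Proof.
split=> [[qp qe]|[qo qu qt]].
  have sum1 a : \sum_k q (@atom_vertex false a k) = 1.
    by rewrite -sum_object_edge; apply: qe; exact: object_edge_in.
  have arrow a b (u : Defs.hom (ob a) (ob b)) k :
      q (atom_vertex false k) = \sum_(l in atoms u k) q (atom_vertex true l).
    have := qe _ (arrow_edge_in u k); rewrite sum_arrow_edge coneE -(sum1 a).
    by rewrite [in RHS](bigD1 k) //= [in RHS]addrC => /addrI.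
  have ft a (k : 'I_(nb (ob a))) : q (atom_vertex true k) = q (atom_vertex false k).
    by rewrite (arrow _ _ (catid (ob a))) atoms_id big_set1.
  split=> // [a|a b u k].
    by apply: sum_projections_partition => // k; exact: qp.
  by rewrite (arrow _ _ u); apply: eq_bigr => l _; rewrite ft.
split=> [[[a k] c]|s /=].
  have [/(_ k) pk _ _] := qo a.
  by case: c; [rewrite -[X in projection X]qt in pk|]; exact: pk.
rewrite inE => /asboolP[[a ->]|[a [b [u [k ->]]]]].
  by rewrite sum_object_edge; have [] := qo a.
rewrite sum_arrow_edge; under [X in _ + X]eq_bigr do rewrite qt.
have [_ _ q1] := qo a.
by rewrite coneE -q1 [in RHS](bigD1 k) //= -(qu _ _ u) addrC.
Qed.

Lemma relations_cocone : @hypergraph_relations R diagram_hypergraph B q ->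
  exists c : cocone D (B : obj (cstar_alg1 R)),
    forall a k, (c (ob a) : starMorphism _ _) (eb k) = q (@atom_vertex false a k).
Proof.
case/diagram_relationsP => qo qu _.
have g_ a : exists g : starMorphism (D (ob a)) B,
    forall k, g (eb k) = q (@atom_vertex false a k).
  exact: atomic_basis_morphism (eb_basis (ob a)) (qo a).
pose g a := projT1 (cid (g_ a)).
have gE a k : g a (eb k) = q (@atom_vertex false a k) by rewrite /g; case: cid.
have g_nat a b (u : Defs.hom (ob a) (ob b)) : starMorphism_comp (g b) (Dmap u) = g a.
  apply: (atomic_basis_morphism_eq (eb_basis (ob a))) => k /=.
  rewrite atomsE linear_sum gE (qu _ _ u); apply: eq_bigr => l _; exact: gE.
(* A leg at an arbitrary [j] is pinned down through all arrows from [j] to enumerated objects, which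
   avoids transport along [ob a = j]. *)
have leg_ j : exists h : starMorphism (D j) B,
    forall a (u : Defs.hom j (ob a)), starMorphism_comp (g a) (Dmap u) = h.
  by have [a <-] := o_surj j; exists (g a).
pose h j := projT1 (cid (leg_ j)).
have hE j a (u : Defs.hom j (ob a)) : starMorphism_comp (g a) (Dmap u) = h j.
  by rewrite /h; case: cid.
have hg a : h (ob a) = g a.
  by rewrite -(hE _ _ (catid (ob a))) /Dmap fmap_id; exact: starMorphism_compf1.
have h_nat i j (u : Defs.hom i j) : starMorphism_comp (h j) (Dmap u) = h i.
  by have [a aj] := o_surj j; subst j; rewrite hg hE.
pose c : cocone D (B : obj (cstar_alg1 R)) :=
  @Cocone J (cstar_alg1 R) D B h h_nat.
by exists c => a k; rewrite /= hg gE.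
Qed.

End Families.

Definition cocone_family (B : cstarAlgType R) (c : cocone D (B : obj (cstar_alg1 R)))
    (v : dvertex) : B :=
  (c (ob (tag v.1)) : starMorphism _ _) (eb (tagged v.1)).

Lemma cocone_relations (B : cstarAlgType R) (c : cocone D (B : obj (cstar_alg1 R))) :
  @hypergraph_relations R diagram_hypergraph B (cocone_family c).
Proof.
apply/diagram_relationsP; split=> // [a|a b u k].
  by have [pe _ _] := eb_basis (ob a); exact: (morphism_partition (c (ob a)) pe).
rewrite /cocone_family /= -(leg_natural c u) /= -[Defs.fmap D u]/(Dmap u) atomsE.
by rewrite linear_sum.
Qed.

Lemma relations_false (B : cstarAlgType R) (q : dvertex -> B) :
  @hypergraph_relations R diagram_hypergraph B q ->
  forall v, q v = q (v.1, false).
Proof. by case/diagram_relationsP => _ _ qt [[a k] []] //=; exact: qt. Qed.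

(** Cocones with vertex [B] correspond to families in [B] satisfying the relations, compatibly with
    morphisms, so the two universal properties coincide. *)
Lemma diagram_colimitP (L : cstarAlgType R) :
  is_colimit D (L : obj (cstar_alg1 R)) <-> is_free_hypergraph_cstar diagram_hypergraph L.
Proof.
split=> [[c cU]|[p [prel pU]]].
  exists (cocone_family c); split=> [|B q qrel]; first exact: cocone_relations.
  have [c' c'q] := relations_cocone qrel.
  have [h [hc hU]] := cU B c'; exists h; split=> [v|h' h'q].
    rewrite (relations_false qrel) (relations_false (cocone_relations c)).
    case: v => -[a k] b /=; rewrite -[RHS]c'q -hc; reflexivity.
  apply: hU => j; have [a <-] := o_surj j.
  apply: (atomic_basis_morphism_eq (eb_basis (ob a))) => k.
  rewrite c'q; exact: (h'q (atom_vertex false k)).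
have [c cp] := relations_cocone prel; exists c => B c'.
have [h [hp hU]] := pU _ _ (cocone_relations c').
exists h; split=> [j|h' h'c].
  have [a <-] := o_surj j.
  apply: (atomic_basis_morphism_eq (eb_basis (ob a))) => k.
  have /= -> := cp a k; exact: (hp (atom_vertex false k)).
apply: hU => v; rewrite (relations_false prel) (relations_false (cocone_relations c')).
case: v => -[a k] b /=; have /= <- := cp a k.
by have := h'c (ob a) => /(congr1 (fun f : starMorphism _ _ => f (eb k))).
Qed.

End DiagramHypergraph.

Lemma colimit_free_hypergraph (R : realType) (J : category)
    (D : functor J (cstar_alg1 R)) : finite_category J ->
    (forall j, commutative_cstar (D j) /\ finite_dimensional (D j)) ->
  exists H : hypergraph, forall L : cstarAlgType R,
    is_colimit D (L : obj (cstar_alg1 R)) <-> is_free_hypergraph_cstar H L.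
Proof.
move=> [[n [ob o_surj]] _] Dfd.
have basis j : exists n (e : 'I_n -> (D j : cstarAlgType R)), atomic_basis e.
  by have [cD fD] := Dfd j; exact: commutative_atomic_basis.
pose nb j := projT1 (cid (basis j)).
pose eb j : 'I_(nb j) -> (D j : cstarAlgType R) := projT1 (cid (projT2 (cid (basis j)))).
have eb_basis j : atomic_basis (@eb j) := projT2 (cid (projT2 (cid (basis j)))).
by exists (diagram_hypergraph ob eb_basis) => L; exact: diagram_colimitP.
Qed.

(** * Free hypergraph algebras are finite colimits *)

Lemma gval_sum (R : realType) (V : Type) (F : gen_family R V) I (s : seq I)
    (P : pred I) (f : I -> gen_alg F) i :
  (\sum_(k <- s | P k) f k) i = \sum_(k <- s | P k) f k i.
Proof.
exact: (big_morph (fun x : gen_alg F => gval x i) (id1 := 0) (op1 := +%R)).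
Qed.

(** * The algebras [C^X] and their pullbacks *)

Section FunctionAlgebra.
Variable R : realType.

Let delta (X : finType) (i v : X) : complex_alg R := ((i == v)%:R : R[i]).

Let delta_bounded (X : finType) (v : X) : exists c, forall i, nrm (delta i v) <= c.
Proof.
exists 1 => i; rewrite /delta; case: eqP => _; first exact: (@nrm1_le _ (complex_alg R)).
by rewrite (_ : nrm _ = 0) ?ler01 //; exact: (@nrm0 _ (complex_alg R)).
Qed.

(** One representation in the complex numbers per point, the generators being the indicator
    functions of points. *)
Definition fun_family (X : finType) : gen_family R X := GenFamily (@delta_bounded X).
Definition fun_alg (X : finType) : cstarAlgType R := gen_alg (fun_family X).

Lemma fun_approximable (X : finType) (f : X -> complex_alg R) :
  @approximable _ _ (fun_family X) f.
Proof.
have -> : f = fun i => \sum_v (f v : R[i]) *: (delta i v : complex_alg R).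
  apply/funext => i; rewrite (bigD1 i) //= big1 => [|v vi].
    by rewrite addr0 /delta eqxx /GRing.scale /= mulr1.
  by rewrite /delta eq_sym (negPf vi) scaler0.
elim: (index_enum X) => [|v s IH].
  by under eq_fun do rewrite big_nil; exact: (approx0 (fun_family X)).
under eq_fun do rewrite big_cons.
apply: (@approxD _ _ (fun_family X)) => //.
apply: (@approxZ _ _ (fun_family X)).
exact: (approx_teval (fun_family X) (Tvar R v)).
Qed.

Definition fun_elt (X : finType) (f : X -> complex_alg R) : fun_alg X :=
  GenAlg (@fun_approximable X f).

Lemma fun_alg_basis (X : finType) :
  atomic_basis (fun v => ggen (fun_family X) v : fun_alg X).
Proof.
have gd v i : ggen (fun_family X) v i = delta i v by [].
split; first split.
- move=> v; split; apply: gen_alg_eq => i; rewrite /= /delta; case: eqP => _.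
  + exact: (@star1 _ (complex_alg R)).
  + exact: (@star0 _ (complex_alg R)).
  + exact: (@mulr1 (complex_alg R)).
  + exact: (@mulr0 (complex_alg R)).
- move=> v w vw; apply: gen_alg_eq => i; rewrite /= /delta.
  have [->|_] := eqVneq i v; last exact: (@mul0r (complex_alg R)).
  by rewrite (negPf vw); exact: (@mulr0 (complex_alg R)).
- apply: gen_alg_eq => i; rewrite gval_sum (bigD1 i) //= big1 => [|v vi].
    by rewrite addr0 /delta eqxx.
  by rewrite /delta eq_sym (negPf vi).
- move=> v /(congr1 (fun x : gen_alg (fun_family X) => x v)); rewrite /= /delta eqxx.
  by move/eqP; rewrite oner_eq0.
- move=> x; exists x; apply: gen_alg_eq => i.
  rewrite gval_sum (bigD1 i) //= big1 => [|v vi].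
    by rewrite addr0 /delta eqxx /GRing.scale /= mulr1.
  by rewrite /delta eq_sym (negPf vi) scaler0.
Qed.

Lemma fun_alg_commutative X : commutative_cstar (fun_alg X).
Proof. by move=> x y; apply: gen_alg_eq => i; exact: (@mulrC R[i]). Qed.

Lemma atomic_basis_finite_dimensional (A : cstarAlgType R) (X : finType) (e : X -> A) :
  atomic_basis e -> finite_dimensional A.
Proof.
case=> _ _ espan; exists #|X|, (fun i => e (enum_val i)) => x.
have [k ->] := espan x; exists (fun i => k (enum_val i)).
by rewrite -(big_enum_val (fun v => k v *: e v)).
Qed.

Lemma pullback_exists (X Y : finType) (phi : Y -> X) :
  exists f : starMorphism (fun_alg X) (fun_alg Y), forall x i, f x i = x (phi i).
Proof.
have [|||x|g gE] := @make_starMorphism _ (fun_alg X) (fun_alg Y)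
    (fun x => fun_elt (fun i => (x : gen_alg _) (phi i))).
- by move=> k x y; apply: gen_alg_eq.
- by apply: gen_alg_eq.
- by move=> x y; apply: gen_alg_eq.
- by apply: gen_alg_eq.
by exists g => x i; rewrite gE.
Qed.

Definition pullback (X Y : finType) (phi : Y -> X) : starMorphism (fun_alg X) (fun_alg Y) :=
  projT1 (cid (pullback_exists phi)).

Lemma pullbackE (X Y : finType) (phi : Y -> X) x i : pullback phi x i = x (phi i).
Proof. by rewrite /pullback; case: cid. Qed.

Lemma pullback_delta (X Y : finType) (phi : Y -> X) v :
  pullback phi (ggen (fun_family X) v) = \sum_(i | phi i == v) ggen (fun_family Y) i.
Proof.
apply: gen_alg_eq => i; rewrite pullbackE /= gval_sum /= /delta.
rewrite big_mkcond (bigD1 i) //= big1 ?addr0 ?eqxx => [|j ji]; first by case: eqP.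
by rewrite [i == j]eq_sym (negPf ji); case: ifP.
Qed.

End FunctionAlgebra.

(** * The incidence diagram of a hypergraph *)

Section IncidenceDiagram.
Variables (R : realType) (H : hypergraph).

Definition incidence_obj : finType :=
  (vertex H + {e : {set vertex H} | e \in edges H})%type.

(** The order of the vertex-edge poset, used as a thin category. *)
Definition incidence (x y : incidence_obj) : bool :=
  match x, y with
  | inl v, inl w => v == w
  | inl v, inr e => v \in val e
  | inr e, inr e' => e == e'
  | inr _, inl _ => false
  end.

Lemma incidence_refl x : incidence x x.
Proof. by case: x => x /=. Qed.

Lemma incidence_trans x y z : incidence y z -> incidence x y -> incidence x z.
Proof.
case: x y z => [v|e] [w|f] [t|g] //=.
- by move=> /eqP <-.
- by move=> wg /eqP ->.
- by move=> /eqP <-.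
- by move=> /eqP <-.
Qed.

Definition incidence_category : category.
Proof.
refine (@Category incidence_obj (fun x y => incidence x y : Prop) incidence_refl
  incidence_trans _ _ _) => *; exact: bool_irrelevance.
Defined.

Lemma incidence_category_finite : finite_category incidence_category.
Proof.
split.
  exists #|incidence_obj|, (fun i => enum_val i) => x; exists (enum_rank x).
  by rewrite enum_rankK.
move=> x y /=; have [xy|nxy] := pselect (incidence x y : Prop).
  by exists 1%N, (fun=> xy) => xy'; exists ord0; exact: bool_irrelevance.
exists 0%N, (fun i : 'I_0 => False_rect _ (notF (ltn_ord i))) => xy.
by case: (nxy xy).
Qed.

(* [C^2] at a vertex [v] carries [p_v] and its complement, [C^e] at an edge [e]
   carries the partition of unity [(p_w)_(w in e)]. *)
Definition incidence_points (x : incidence_obj) : finType :=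
  match x with
  | inl _ => bool
  | inr e => {w : vertex H | w \in val e}
  end.

Lemma mem_same_edge (e e' : {s : {set vertex H} | s \in edges H}) w :
  e == e' -> w \in val e' -> w \in val e.
Proof. by move/eqP ->. Qed.

(** Points map backwards. For [v \in e] the fibre over [true] is the single point [v], so [p_v] goes
    to its minimal projection. *)
Definition incidence_map (x y : incidence_obj) :
    incidence x y -> incidence_points y -> incidence_points x :=
  match x, y return incidence x y -> incidence_points y -> incidence_points x with
  | inl v, inl w => fun _ b => b
  | inl v, inr e => fun _ w => val w == v
  | inr e, inr e' => fun ee' w => exist _ (val w) (mem_same_edge ee' (valP w))
  | inr e, inl v => fun absurd => False_rect _ (notF absurd)
  end.

Lemma incidence_map_id x (u : incidence x x) i : incidence_map u i = i.
Proof. by case: x u i => [v|e] u i //=; apply: val_inj. Qed.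

Lemma incidence_map_comp x y z (v : incidence y z) (u : incidence x y)
    (w : incidence x z) i :
  incidence_map w i = incidence_map u (incidence_map v i).
Proof.
case: x y z v u w i => [a|e] [b|f] [c|g] //= v u w i; last exact: val_inj.
by rewrite (eqP u).
Qed.

Definition incidence_diagram : functor incidence_category (cstar_alg1 R).
Proof.
refine (@Functor incidence_category (cstar_alg1 R)
  (fun x => fun_alg R (incidence_points x)) (fun x y u => pullback R (incidence_map u)) _ _).
- move=> x; apply: starMorphism_eq => f; apply: gen_alg_eq => i.
  by rewrite pullbackE incidence_map_id.
- move=> x y z v u; apply: starMorphism_eq => f; apply: gen_alg_eq => i.
  rewrite /= !pullbackE; congr (gval f _); exact: incidence_map_comp.
Defined.

Let dl x (i : incidence_points x) : fun_alg R (incidence_points x) :=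
  ggen (fun_family R (incidence_points x)) i.

Let dl_basis x : atomic_basis (@dl x) := fun_alg_basis R (incidence_points x).

Lemma sum_edge_points (A : zmodType) (e : {s : {set vertex H} | s \in edges H})
    (F : vertex H -> A) :
  \sum_(w : incidence_points (inr e)) F (val w) = \sum_(v in val e) F v.
Proof. by rewrite -big_sub. Qed.

Section Points.
Variables (A : cstarAlgType R) (p : vertex H -> A).
Hypothesis prel : hypergraph_relations p.

Definition point_family (x : incidence_obj) : incidence_points x -> A :=
  match x return incidence_points x -> A with
  | inl v => fun b => if b then p v else 1 - p v
  | inr e => fun w => p (val w)
  end.

Lemma point_family_partition x : partition_of_unity (@point_family x).
Proof.
have [pp pe] := prel; apply: sum_projections_partition; case: x => [v|e] /=.
- by case; [exact: pp|apply: projection1B].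
- by move=> w; exact: pp.
- by rewrite big_bool /= addrC subrK.
- by rewrite (sum_edge_points e p) pe //; exact: (valP e).
Qed.

(** The case with content is [v \in e]: the fibre over [false] sums to [1 - p v] by the relation of
    [e]. *)
Lemma point_family_natural x y (u : incidence x y) k :
  \sum_(l | incidence_map u l == k) point_family l = point_family k.
Proof.
case: x y u k => [v|e] [w|f] //= u k.
- by rewrite (big_pred1 k) ?(eqP u).
- have [pp pe] := prel.
  have wv : val (exist _ v u : incidence_points (inr f)) = v by [].
  have pv : \sum_(l : incidence_points (inr f) | val l == v) p (val l) = p v.
    by rewrite (big_pred1 (exist _ v u)) // => l; rewrite /= -val_eqE.
  case: k; first by rewrite -[RHS]pv; apply: eq_bigl => l; rewrite eqb_id.
  have := sum_edge_points f p; rewrite (pe _ (valP f)) coneE.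
  rewrite (bigID (fun l => val l == v)) /= pv => <-; rewrite addrC addrK.
  by apply: eq_bigl => l; rewrite eqbF_neg.
- by rewrite (big_pred1 (exist _ (val k) (mem_same_edge (etrans (eq_sym _ _) u) (valP k)))) //.
Qed.

Lemma relations_incidence_cocone :
  exists c : cocone incidence_diagram (A : obj (cstar_alg1 R)),
    forall x i, (c x : starMorphism _ _) (dl i) = point_family i.
Proof.
have leg_ x : exists g : starMorphism (fun_alg R (incidence_points x)) A,
    forall i, g (dl i) = point_family i.
  exact: atomic_basis_morphism (dl_basis x) (point_family_partition x).
pose g x := projT1 (cid (leg_ x)).
have gE x i : g x (dl i) = point_family i by rewrite /g; case: cid.
have g_nat x y (u : incidence x y) :
    starMorphism_comp (g y) (pullback R (incidence_map u)) = g x.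
  apply: (atomic_basis_morphism_eq (dl_basis x)) => k /=.
  rewrite pullback_delta linear_sum gE -(point_family_natural u).
  by apply: eq_bigr => l _; exact: gE.
by exists (@Cocone incidence_category (cstar_alg1 R) incidence_diagram A g g_nat).
Qed.
End Points.

(** A cocone is determined by the images [q v] of the points [true]: naturality along [v \in e]
    forces the value [q v] on the point [v] of [e], and thereby the relation of [e]. *)
Lemma free_incidence_colimit (A : cstarAlgType R) :
  is_free_hypergraph_cstar H A -> is_colimit incidence_diagram (A : obj (cstar_alg1 R)).
Proof.
move=> [p [prel pU]]; have [c cE] := relations_incidence_cocone prel.
exists c => B c'.
pose leg' x : starMorphism (fun_alg R (incidence_points x)) B := c' x.
pose q v : B := leg' (inl v) (@dl (inl v) true).
have leg_part x := morphism_partition (leg' x) (let: And3 h _ _ := dl_basis x in h).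
have q_edge (e : {s | s \in edges H}) (w : incidence_points (inr e)) :
    q (val w) = leg' (inr e) (dl w).
  have u : incidence (inl (val w)) (inr e) := valP w.
  have := leg_natural c' (u : Defs.hom (c := incidence_category) _ _).
  move/(congr1 (fun f : starMorphism _ _ => f (@dl (inl (val w)) true))) => h.
  have dE : pullback R (incidence_map u) (@dl (inl (val w)) true) = dl w.
    by rewrite pullback_delta (big_pred1 w) // => l /=; rewrite -val_eqE eqb_id.
  exact: etrans (esym h) (congr1 (leg' (inr e)) dE).
have qrel : hypergraph_relations q.
  split=> [v|e eH]; first by have [/(_ true)] := leg_part (inl v).
  rewrite -(sum_edge_points (exist _ e eH) q).
  under eq_bigr do rewrite q_edge.
  by have [] := leg_part (inr (exist _ e eH)).
have [h [hp hU]] := pU B q qrel; exists h; split=> [x|h' h'c].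
  apply: (atomic_basis_morphism_eq (dl_basis x)) => i /=.
  rewrite cE; case: x i => [v|e] i /=; last by rewrite hp q_edge.
  case: i; first exact: hp.
  have -> : h (1 - p v) = 1 - q v.
    by rewrite linearB; congr (_ - _); [exact: (star_morph1r h)|exact: hp].
  have [_ _] := leg_part (inl v); rewrite big_bool /= => <-.
  by rewrite /q addrC addrK.
apply: hU => v; have /(congr1 (fun f : starMorphism _ _ => f (@dl (inl v) true))) := h'c (inl v).
by rewrite /= cE.
Qed.

End IncidenceDiagram.

Theorem theorem2p16 (R : realType) :
  (forall H : hypergraph,
     (exists A : cstarAlgType R, is_free_hypergraph_cstar H A) /\
     forall A : cstarAlgType R, is_free_hypergraph_cstar H A ->
       exists (J : category) (D : functor J (cstar_alg1 R))
              (L : obj (cstar_alg1 R)),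
         [/\ finite_category J,
             forall j, commutative_cstar (D j) /\ finite_dimensional (D j),
             is_colimit D L
           & @isomorphic (cstar_alg1 R) A L]) /\
  (forall (J : category) (D : functor J (cstar_alg1 R)),
     finite_category J ->
     (forall j, commutative_cstar (D j) /\ finite_dimensional (D j)) ->
     (exists L, is_colimit D L) /\
     forall L, is_colimit D L ->
       exists (H : hypergraph) (A : cstarAlgType R),
         is_free_hypergraph_cstar H A /\ @isomorphic (cstar_alg1 R) L A).
Proof.
(* In both directions a single algebra is free and a colimit, so the isomorphisms are identities. *)
have iso_refl (A : obj (cstar_alg1 R)) : isomorphic A A.
  by exists (catid A), (catid A); split; exact: catcomp1f.
split=> [H|J D finJ Dfd].
  split=> [|A Afree]; first exact: free_hypergraph_exists.
  exists (incidence_category H), (incidence_diagram R H), A; split=> //.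
  - exact: incidence_category_finite.
  - move=> x; split; first exact: fun_alg_commutative.
    exact: atomic_basis_finite_dimensional (fun_alg_basis R (incidence_points x)).
  - exact: free_incidence_colimit.
have [H HD] := colimit_free_hypergraph finJ Dfd.
split=> [|L Lcolim].
  by have [A Afree] := free_hypergraph_exists R H; exists A; apply/HD.
by exists H, L; split; [apply/HD|exact: iso_refl].
Qed.
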